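(* The group of characters $\mathbb X(\overline{\mathbf\Pi})$ of the Hopf monoid of permutahedra $\overline{\mathbf\Pi}$ is isomorphic to the group of exponential formal power series $$\Big\{1+a_1x+a_2\frac{x^2}{2!}+a_3\frac{x^3}{3!}+\cdots \;:\; a_1,a_2,\ldots\in\Bbbk\Big\}$$ under multiplication.
   Context: $\Bbbk$ is a field of characteristic $0$. For a finite set $I$, $\mathbb R I$ is the real vector space with basis $\{e_i\}_{i\in I}$. The standard permutahedron $\pi_I\subseteq\mathbb RI$ is the convex hull of the $|I|!$ points $(a_i)_{i\in I}$ with $\{a_i\}_{i\in I}=\{1,\dots,|I|\}$. A generalized permutahedron in $\mathbb RI$ is a nonempty polytope whose normal fan coarsens the fan of the braid arrangement (hyperplanes $y(i)=y(j)$ in the dual space $\mathbb R^I$). Two generalized permutahedra in $\mathbb RI$ are normally equivalent if they have the same normal fan. $\mathrm{GP}[I]$ is the set of generalized permutahedra in $\mathbb RI$. It carries, for each ordered decomposition $I=S\sqcup T$ (parts may be empty), the product $\mathfrak p\cdot\mathfrak q=\mathfrak p\times\mathfrak q$ ($\mathfrak p\in\mathrm{GP}[S]$, $\mathfrak q\in\mathrm{GP}[T]$) and the coproduct $\Delta_{S,T}(\mathfrak p)=(\mathfrak p|_S,\mathfrak p/_S)\in\mathrm{GP}[S]\times\mathrm{GP}[T]$, where $\mathfrak p|_S\times\mathfrak p/_S$ is the face of $\mathfrak p$ maximizing $\sum_{i\in S}x_i$. These operations make $\mathrm{GP}$ a connected Hopf monoid and descend to the quotient $\overline{\mathrm{GP}}$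 of normal equivalence classes. $\overline{\Pi}$ is the Hopf submonoid of $\overline{\mathrm{GP}}$ generated by the classes of the standard permutahedra $\pi_I$; thus $\overline\Pi[I]$ consists of the classes of products $\pi_{S_1}\times\cdots\times\pi_{S_k}$ with $I=S_1\sqcup\cdots\sqcup S_k$. $\overline{\mathbf\Pi}[I]$ is the $\Bbbk$-vector space with basis $\overline\Pi[I]$. A character $\zeta$ of a connected Hopf monoid $\mathbf H$ (with $\mathbf H[\emptyset]=\Bbbk$) is a family of linear maps $\zeta_I:\mathbf H[I]\to\Bbbk$, one for each finite set $I$, that is natural ($\zeta_J(\mathbf H[\sigma](x))=\zeta_I(x)$ for bijections $\sigma:I\to J$), multiplicative ($\zeta_I(x\cdot y)=\zeta_S(x)\zeta_T(y)$ for $I=S\sqcup T$, $x\in\mathbf H[S]$, $y\in\mathbf H[T]$), and unital ($\zeta_\emptyset(1)=1$). The characters form a group $\mathbb X(\mathbf H)$ under convolution $(\varphi\psi)_I(x)=\sum_{I=S\sqcup T}\varphi_S(x|_S)\,\psi_T(x/_S)$, the sum over all ordered decompositions. *)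

(* Defs.v *)
From HB Require Import structures.
From mathcomp Require Import all_boot all_order all_algebra.
From mathcomp Require Import all_classical all_reals.
From mathcomp.multinomials Require Import freeg.

Set Implicit Arguments.
Unset Strict Implicit.
Unset Printing Implicit Defensive.

Import Order.TTheory GRing.Theory Num.Theory.
Local Open Scope classical_set_scope.
Local Open Scope ring_scope.

(* Points of the vector space with basis I, and vectors of its dual, are both
   given by their coordinate functions I -> R. *)
Section Polytopes.
Context (R : realType).
Implicit Types (I J : finType).

Definition pairing I (y x : I -> R) : R := \sum_i y i * x i.

Definition convex_hull I (A : set (I -> R)) : set (I -> R) :=
  [set x | exists n (c : 'I_n -> R) (v : 'I_n -> (I -> R)),
     [/\ forall k, 0 <= c k, \sum_k c k = 1, forall k, A (v k)
       & forall i, x i = \sum_k c k * v k i]].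

Definition nonempty_polytope I (p : set (I -> R)) : Prop :=
  exists A : set (I -> R), [/\ finite_set A, A !=set0 & p = convex_hull A].

Definition max_face I (p : set (I -> R)) (y : I -> R) : set (I -> R) :=
  [set x | p x /\ forall z, p z -> pairing y z <= pairing y x].

Definition normal_cone I (p q : set (I -> R)) : set (I -> R) :=
  [set y | q `<=` max_face p y].

Definition normal_fan I (p : set (I -> R)) : set (set (I -> R)) :=
  [set normal_cone p (max_face p y) | y in [set: I -> R]].

(* The closed cone of the arrangement of hyperplanes y i = y j whose relative
   interior contains y0. *)
Definition braid_cone I (y0 : I -> R) : set (I -> R) :=
  [set y | forall i j, y0 i <= y0 j -> y i <= y j].

Definition braid_fan I : set (set (I -> R)) := range (@braid_cone I).

Definition coarsens I (F G : set (set (I -> R))) : Prop :=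
  (forall C, G C -> exists2 D, F D & C `<=` D) /\
  \bigcup_(D in F) D = \bigcup_(C in G) C.

Definition gen_permutahedron I (p : set (I -> R)) : Prop :=
  nonempty_polytope p /\ coarsens (normal_fan p) (@braid_fan I).

Definition normally_equivalent I (p q : set (I -> R)) : Prop :=
  normal_fan p = normal_fan q.

Definition permutahedron I : set (I -> R) :=
  convex_hull [set a : I -> R | range a = [set n%:R | n in [set n | 1 <= n <= #|I|]%N]].

End Polytopes.

Arguments braid_fan R I : clear implicits.
Arguments permutahedron R I : clear implicits.

Notation sub S := {i | i \in S}.

(* An ordered decomposition of I is given by its first part S : {set I}, the
   second part being ~: S. *)
Section Operations.
Context (R : realType).
Implicit Types (I J : finType).

Definition restr I (S : {set I}) (x : I -> R) : sub S -> R :=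
  fun i => x (val i).

Definition poly_prod I (S : {set I})
    (p : set (sub S -> R)) (q : set (sub (~: S) -> R)) : set (I -> R) :=
  [set x | p (restr x) /\ q (restr x)].

Definition indicator I (S : {set I}) : I -> R := fun i => (i \in S)%:R.

(* p|_S = q and p/_S = r; since the face is nonempty when p is a polytope,
   q and r are determined by p. *)
Definition poly_coprod I (S : {set I}) (p : set (I -> R))
    (q : set (sub S -> R)) (r : set (sub (~: S) -> R)) : Prop :=
  poly_prod q r = max_face p (indicator S).

(* The linear isomorphism sending e_i to e_(sigma i) pulls coordinates back
   along sigma. *)
Definition poly_relabel I J (sigma : I -> J) (p : set (I -> R)) :
    set (J -> R) :=
  [set x : J -> R | p (x \o sigma)].

Definition nclass I (p : set (I -> R)) : set (set (I -> R)) :=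
  [set q | gen_permutahedron q /\ normally_equivalent q p].

Definition perm_prod I (P : {set {set I}}) : set (I -> R) :=
  [set x | forall B, B \in P -> permutahedron R (sub B) (restr x)].

End Operations.

Arguments restr {R I} S x.
Arguments indicator R {I} S.
Arguments perm_prod R {I} P.

Section HopfMonoid.
Context (R : realType).
Implicit Types (I J : finType).

Definition is_pibar I : set (set (set (I -> R))) :=
  [set C | exists2 P : {set {set I}}, finset.partition P [set: I]%SET
                                    & C = nclass (perm_prod R P)].

Definition Pibar I : Type := {C : set (set (I -> R)) | C \in @is_pibar I}.
HB.instance Definition _ I := SubChoice.on (Pibar I).

Lemma is_pibar_points I :
  nclass (perm_prod R (preim_partition id [set: I]%SET)) \in @is_pibar I.
Proof. by apply/mem_set; exists (preim_partition id [set: I]%SET) => //; exact: preim_partitionP. Qed.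

(* The element of Pibar I with underlying class C.  The operations below always
   produce elements of Pibar I, because the faces of a product of standard
   permutahedra are normally equivalent to such products; the value outside
   is_pibar is thus never used. *)
Definition to_pibar I (C : set (set (I -> R))) : Pibar I :=
  insubd (SigSub (is_pibar_points I) : Pibar I) C.

Definition pibar_relabel I J (sigma : I -> J) (C : Pibar I) : Pibar J :=
  to_pibar [set q' | exists2 p, val C p & nclass (poly_relabel sigma p) q'].

Definition pibar_mul I (S : {set I}) (C : Pibar (sub S))
    (D : Pibar (sub (~: S))) : Pibar I :=
  to_pibar [set p' | exists p q,
    [/\ val C p, val D q & nclass (poly_prod p q) p']].

(* R^void is a point. *)
Definition pibar_one : Pibar void := to_pibar (nclass [set: void -> R]).

Definition pibar_restr I (S : {set I}) (C : Pibar I) : Pibar (sub S) :=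
  to_pibar [set q' | exists p q r,
    [/\ val C p, poly_coprod p q r & nclass q q']].

Definition pibar_contr I (S : {set I}) (C : Pibar I) : Pibar (sub (~: S)) :=
  to_pibar [set r' | exists p q r,
    [/\ val C p, poly_coprod (S := S) p q r & nclass r r']].

End HopfMonoid.

Section Characters.
Context (R : realType) (k : fieldType).
Implicit Types (I J : finType).

Definition kPibar I : lmodType k := {freeg (Pibar R I) / k}.

Definition kpibar_relabel I J (sigma : I -> J) (x : kPibar I) : kPibar J :=
  fglift (fun C => << pibar_relabel sigma C >> : kPibar J) x.

Definition kpibar_mul I (S : {set I}) (x : kPibar (sub S))
    (y : kPibar (sub (~: S))) : kPibar I :=
  fglift (fun C =>
    fglift (fun D => << pibar_mul C D >> : kPibar I) y) x.

Definition char_family : Type := forall I, kPibar I -> k.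

Record is_character (zeta : char_family) : Prop := IsCharacter {
  character_linear : forall I, scalar (zeta I);
  character_natural : forall I J (sigma : I -> J) (x : kPibar I),
    bijective sigma -> zeta J (kpibar_relabel sigma x) = zeta I x;
  character_mul : forall I (S : {set I}) (x : kPibar (sub S))
      (y : kPibar (sub (~: S))),
    zeta I (kpibar_mul x y) = zeta (sub S) x * zeta (sub (~: S)) y;
  character_one : zeta void << pibar_one R >> = 1 }.

(* The coproduct of the vector species is the linear extension of
   C |-> C|_S (x) C/_S. *)
Definition convolution (phi psi : char_family) : char_family := fun I =>
  fglift (fun C : Pibar R I => (\sum_(S : {set I})
    phi (sub S) << pibar_restr S C >> *
    psi (sub (~: S)) << pibar_contr S C >>) : k^o).

End Characters.

Section PowerSeries.
Context (k : fieldType).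

(* Formal power series, as sequences of coefficients. *)
Definition fps : Type := nat -> k.

Definition fps_mul (f g : fps) : fps :=
  fun n => \sum_(i < n.+1) f i * g (n - i)%N.

Definition exp_series (a : nat -> k) : fps := fun n => a n / n`!%:R.

Definition is_unital_exp_series (f : fps) : Prop :=
  exists2 a : nat -> k, a 0%N = 1 & f = exp_series a.

End PowerSeries.

(* Groups whose elements are those of a type T that satisfy G; predicates are
   used rather than sets because the type of families is too large for the
   universe of set. *)
Record is_group (T : Type) (G : T -> Prop) (op : T -> T -> T) : Prop :=
  IsGroup {
    group_closed : forall x y, G x -> G y -> G (op x y);
    group_assoc : forall x y z, G x -> G y -> G z ->
      op x (op y z) = op (op x y) z;
    group_unit_inv : exists e, [/\ G e,
      forall x, G x -> op e x = x /\ op x e = x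
      & forall x, G x -> exists y, [/\ G y, op x y = e & op y x = e]] }.

Record is_group_iso (T U : Type) (G : T -> Prop) (opG : T -> T -> T)
    (H : U -> Prop) (opH : U -> U -> U) (f : T -> U) : Prop := IsGroupIso {
  iso_maps : forall x, G x -> H (f x);
  iso_inj : forall x y, G x -> G y -> f x = f y -> x = y;
  iso_surj : forall z, H z -> exists2 x, G x & f x = z;
  iso_morph : forall x y, G x -> G y -> f (opG x y) = opH (f x) (f y) }.

(* Main.v *)
Require Import Defs.
From HB Require Import structures.
From mathcomp Require Import all_boot all_order all_algebra.
From mathcomp Require Import all_classical all_reals.
From mathcomp.multinomials Require Import freeg.
From mathcomp Require Import ring lra.

Set Implicit Arguments.
Unset Strict Implicit.
Unset Printing Implicit Defensive.

Import Order.TTheory GRing.Theory Num.Theory.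
Local Open Scope classical_set_scope.
Local Open Scope ring_scope.

(** Every element of the Hopf monoid is the class of a product of
    permutahedra over the blocks of a partition, and a multiplicative function
    is known on it as soon as it is known on single permutahedra.  By
    naturality a character is therefore a sequence [a] with [a 0 = 1], where
    [a n] is its value on the permutahedron in [n] coordinates.  Conversely
    every such sequence comes from a character, because the class of a product
    of permutahedra determines the partition ([label_class_kernel]).  The face
    of [pi_I] maximizing the indicator of [S] is normally equivalent to
    [pi_S x pi_T], so convolution sends [a] and [b] to
    [sum_i 'C(n, i) a_i b_(n-i)], which is the product of exponential series.

    Partitions are handled as labelings [f : I -> L], the blocks being the
    fibers.  Labelings restrict to subsets and glue along decompositions by
    mere composition, and the value of a character becomes a product over all
    labels, including those of empty fibers, which contribute [a 0 = 1].

    The geometric part rests on recording the normal fan of [p] as the preorder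
    [face_le p] on functionals: [y'] is above [y] when the face of [p]
    maximizing [y] is contained in the one maximizing [y'].  Normal equivalence
    is equality of these preorders ([normally_equivalentP]), and all operations
    are computed on preorders, hence are independent of representatives.  Two
    facts are needed.  For the product of permutahedra with blocks [f],
    [face_le] says that [y'] is weakly ordered like [y] inside each block
    ([block_perm_face_le]); this comes from the description of a permutahedron
    as a sum of segments, one for each pair of coordinates.  And for a
    restriction or contraction, the preorder is read off from that of [p] by a
    small perturbation of the indicator of [S] ([face_le_proj]). *)

(** * The group of formal power series *)

Section FpsGroup.
Context (k : fieldType).
Implicit Types f g h : fps k.

(** A coefficient of a product involves only truncations of the factors, so
    the ring laws follow from those of polynomials. *)
Lemma fps_mul_poly m f g n : (n < m)%N ->
  fps_mul f g n = ((\poly_(i < m) f i) * (\poly_(i < m) g i))`_n.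
Proof.
move=> n_lt; rewrite coefM; apply: eq_bigr => i _.
by rewrite !coef_poly !(leq_ltn_trans _ n_lt) ?leq_subr // -ltnS.
Qed.

Lemma fps_mulC f g : fps_mul f g = fps_mul g f.
Proof.
by apply/funext => n; rewrite !(@fps_mul_poly n.+1) // mulrC.
Qed.

Lemma fps_mul_coef0 f g : fps_mul f g 0%N = f 0%N * g 0%N.
Proof. by rewrite /fps_mul big_ord1. Qed.

Lemma fps_mulA f g h : fps_mul f (fps_mul g h) = fps_mul (fps_mul f g) h.
Proof.
apply/funext => n.
pose t (u : fps k) := \poly_(i < n.+1) u i.
have mulE u (p : {poly k}) (v : fps k) : (forall i, (i <= n)%N -> v i = p`_i) ->
    fps_mul u v n = (t u * p)`_n.
  move=> vE; rewrite coefM; apply: eq_bigr => i _.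
  by rewrite coef_poly ltn_ord vE // leq_subr.
rewrite (mulE _ (t g * t h)); last by move=> i ?; apply: fps_mul_poly.
rewrite (fps_mulC (fps_mul f g)) (mulE _ (t f * t g)); last by move=> i ?; apply: fps_mul_poly.
by rewrite mulrA mulrC.
Qed.

Definition fps_one : fps k := fun n => (n == 0)%:R.

Lemma fps_mul1 f : fps_mul fps_one f = f.
Proof.
apply/funext => n; rewrite /fps_mul big_ord_recl subn0 mul1r big1 ?addr0 //.
by move=> i _; rewrite /fps_one /= mul0r.
Qed.

(** The equation [f * g = 1] is solved for [g] degree by degree; a list is
    built because each coefficient uses all the previous ones. *)
Fixpoint fps_inv_coefs f n : seq k :=
  if n is m.+1 then
    let s := fps_inv_coefs f m in
    rcons s ((m == 0%N)%:R - \sum_(i < m) f i.+1 * s`_(m.-1 - i))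
  else [::].

Lemma fps_inv_exists f : f 0%N = 1 ->
  exists2 g : fps k, g 0%N = 1 & fps_mul f g = fps_one.
Proof.
move=> f0; pose s := fps_inv_coefs f; pose g : fps k := fun n => (s n.+1)`_n.
have size_s n : size (s n) = n by elim: n => //= n IH; rewrite size_rcons IH.
have sE n m : (m < n)%N -> (s n)`_m = g m.
  elim: n => // n IH; rewrite ltnS leq_eqVlt => /orP[/eqP->//|lt_mn].
  by rewrite -(IH lt_mn) /= nth_rcons size_s lt_mn.
have gE n : g n = (n == 0%N)%:R - \sum_(i < n) f i.+1 * g (n.-1 - i)%N.
  rewrite /g /= nth_rcons size_s ltnn eqxx; congr (_ - _).
  apply: eq_bigr => i _; rewrite sE //.
  by case: n i => [[]//|n] i /=; rewrite ltnS leq_subr.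
exists g; first by rewrite gE big_ord0 subr0.
apply/funext => n; rewrite /fps_mul big_ord_recl f0 mul1r subn0 gE.
have -> : \sum_(i < n) f (fintype.lift ord0 i) * g (n - fintype.lift ord0 i)%N
    = \sum_(i < n) f i.+1 * g (n.-1 - i)%N.
  by apply: eq_bigr => i _; rewrite /= /bump /= -[n.-1]subn1 -subnDA.
by rewrite subrK.
Qed.

Context (char0 : [pchar k] =i pred0).

Lemma fact_neq0 n : n`!%:R != 0 :> k.
Proof.
have /pcharf0P -> := char0; by rewrite -lt0n fact_gt0.
Qed.

(** Factorials are invertible, so every series is an exponential series. *)
Lemma unital_exp_seriesP f : is_unital_exp_series f <-> f 0%N = 1.
Proof.
split=> [[a a0 ->]|f0]; first by rewrite /exp_series a0 fact0 divr1.
exists (fun n => f n * n`!%:R); first by rewrite f0 mul1r.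
by apply/funext => n; rewrite /exp_series mulfK ?fact_neq0.
Qed.

Lemma fps_group : is_group (@is_unital_exp_series k) (@fps_mul k).
Proof.
split=> [f g|f g h _ _ _|].
- by rewrite !unital_exp_seriesP fps_mul_coef0 => -> ->; rewrite mulr1.
- exact: fps_mulA.
exists fps_one; split.
- by rewrite unital_exp_seriesP.
- by move=> f _; rewrite (fps_mulC f) fps_mul1.
move=> f /unital_exp_seriesP /fps_inv_exists[g g0 fg1].
by exists g; split=> //; [exact/unital_exp_seriesP | rewrite fps_mulC].
Qed.

Definition binomial_conv (a b : nat -> k) : nat -> k :=
  fun n => \sum_(i < n.+1) a i * b (n - i)%N *+ 'C(n, i).

Lemma exp_series_conv a b :
  exp_series (binomial_conv a b) = fps_mul (exp_series a) (exp_series b).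
Proof.
apply/funext => n; rewrite /exp_series mulr_suml; apply: eq_bigr => i _.
have le_in : (i <= n)%N by rewrite -ltnS.
rewrite -(bin_fact le_in) !natrM -[X in X / _]mulr_natr.
have binN0 : 'C(n, i)%:R != 0 :> k.
  by have /pcharf0P -> := char0; rewrite -lt0n bin_gt0.
by field; rewrite !fact_neq0 binN0.
Qed.

Lemma exp_series_inj : injective (@exp_series k).
Proof.
move=> a b ab; apply/funext => n.
by apply: (mulIf (invr_neq0 (fact_neq0 n))); have := congr1 (@^~ n) ab.
Qed.

End FpsGroup.

(** * Multiplicative functions of a labeling *)

Section LabelProducts.
Context (k : fieldType).
Implicit Types (I L : finType) (a b : nat -> k).

Definition fiber I L (f : I -> L) (l : L) : {set I} := [set i | f i == l]%SET.

(** The value, on the product of the permutahedra on the fibers of [f], of the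
    character with value [a n] on a permutahedron in [n] coordinates. *)
Definition label_prod a I L (f : I -> L) : k := \prod_l a #|fiber f l|.

Lemma label_prod_blocks a I L (f : I -> L) : a 0%N = 1 ->
  label_prod a f = \prod_(B in [set fiber f (f i) | i : I]) a #|B|.
Proof.
move=> a0; rewrite /label_prod (bigID (fun l => fiber f l == finset.set0)) /=.
rewrite big1 ?mul1r; last by move=> l /eqP->; rewrite cards0.
have -> : [set fiber f (f i) | i : I]%SET
    = [set fiber f l | l : L & fiber f l != finset.set0]%SET.
  apply/setP => B; apply/imsetP/imsetP => [[i _ ->]|[l + ->]].
    by exists (f i) => //; rewrite inE; apply/set0Pn; exists i; rewrite inE.
  by rewrite inE => /set0Pn[i]; rewrite inE => /eqP<-; exists i.
rewrite big_imset /=; first by apply: eq_bigl => l; rewrite inE.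
move=> l l'; rewrite !inE => /set0Pn[i]; rewrite inE => /eqP<- _.
by move=> /setP/(_ i); rewrite !inE eqxx => /esym/eqP.
Qed.

Lemma label_prod_kernel a I L L' (f : I -> L) (g : I -> L') : a 0%N = 1 ->
  (forall i j, (f i == f j) = (g i == g j)) -> label_prod a f = label_prod a g.
Proof.
move=> a0 fg; rewrite !label_prod_blocks //.
suff -> : [set fiber f (f i) | i : I]%SET = [set fiber g (g i) | i : I]%SET by [].
by apply: eq_imset => i; apply/setP => j; rewrite !inE fg.
Qed.

Lemma card_fiber_restr I L (f : I -> L) (S : {set I}) l :
  #|fiber (fun i : sub S => f (val i)) l| = #|S :&: fiber f l|.
Proof.
rewrite -(card_imset _ val_inj); apply: eq_card => i.
apply/imsetP/idP => [[j + ->]|]; rewrite !inE; first by rewrite (valP j).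
by case/andP=> iS fi; exists (exist _ i iS); rewrite ?inE.
Qed.

Lemma sum_subsets a b I (F : {set I}) :
  \sum_(T : {set I} | T \subset F) a #|T| * b #|F :\: T| =
  binomial_conv a b #|F|.
Proof.
pose c (T : {set I}) : 'I_#|F|.+1 := inord #|T|.
rewrite (partition_big c xpredT) //=; apply: eq_bigr => i _.
rewrite -cards_draws -sumr_const [LHS]big_mkcond [RHS]big_mkcond /=.
apply: eq_bigr => T _; rewrite inE; case: (boolP (T \subset F)) => //= TF.
have -> : (c T == i) = (#|T| == i).
  by rewrite -val_eqE /= inordK // ltnS subset_leq_card.
by case: eqP => // <-; rewrite cardsD (finset.setIidPr TF).
Qed.

(** A subset of [I] is the same thing as a choice of a subset of each fiber,
    so the sum over subsets distributes over the product over labels. *)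
Lemma sum_label_prod a b I L (f : I -> L) :
  \sum_(S : {set I}) label_prod a (fun i : sub S => f (val i)) *
                     label_prod b (fun i : sub (~: S) => f (val i))
  = label_prod (binomial_conv a b) f.
Proof.
rewrite /label_prod; under [RHS]eq_bigr do rewrite -sum_subsets.
rewrite bigA_distr_big_dep /=.
pose cut (S : {set I}) : {ffun L -> {set I}} := [ffun l => S :&: fiber f l].
pose glue (h : {ffun L -> {set I}}) : {set I} := [set i | i \in h (f i)]%SET.
rewrite [RHS](reindex_onto cut glue) /=.
  apply: eq_big => [S|S _].
    rewrite unfold_in; symmetry; apply/andP; split.
      by apply/forallP => l; rewrite ffunE unfold_in subsetIr.
    by apply/eqP/setP => i; rewrite !inE ffunE !inE eqxx andbT.
  rewrite -big_split; apply: eq_bigr => l _; rewrite !card_fiber_restr ffunE.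
  congr (_ * b #|pred_of_set _|); apply/setP => i; rewrite !inE.
  by case: (i \in S); case: eqP.
move=> h /familyP hF; apply/ffunP => l; rewrite ffunE; apply/setP => i.
have /fintype.subsetP/(_ i) := hF l; rewrite !inE.
by case: (f i =P l) => [-> _|_]; rewrite ?andbT // andbF; case: (i \in _) => // /(_ isT).
Qed.

End LabelProducts.

(** * Faces of convex hulls *)

Section Faces.
Context (R : realType).
Implicit Types (I J L : finType).

Lemma pairingDZ I (u v x : I -> R) t :
  pairing (fun i => u i + t * v i) x = pairing u x + t * pairing v x.
Proof.
rewrite /pairing mulr_sumr -big_split; apply: eq_bigr => i _ /=.
by rewrite mulrDl mulrA.
Qed.

Lemma pairing_comb I n (c : 'I_n -> R) (v : 'I_n -> I -> R) (x y : I -> R) :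
  (forall i, x i = \sum_k c k * v k i) ->
  pairing y x = \sum_k c k * pairing y (v k).
Proof.
move=> xE; rewrite /pairing; under eq_bigr do rewrite xE mulr_sumr.
rewrite exchange_big; apply: eq_bigr => l _; rewrite mulr_sumr.
by apply: eq_bigr => i _; rewrite mulrCA.
Qed.

Lemma sub_convex_hull I (A : set (I -> R)) : A `<=` convex_hull A.
Proof.
move=> a Aa; exists 1%N, (fun=> 1), (fun=> a).
by split=> //; [rewrite big_ord1 | move=> i; rewrite big_ord1 mul1r].
Qed.

Lemma convex_hullS I (A B : set (I -> R)) :
  A `<=` B -> convex_hull A `<=` convex_hull B.
Proof. by move=> AB x [n [c [v [c0 c1 Av xE]]]]; exists n, c, v; split; auto. Qed.

Lemma convex_hull_le I (A : set (I -> R)) y m :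
  (forall a, A a -> pairing y a <= m) ->
  forall x, convex_hull A x -> pairing y x <= m.
Proof.
move=> Am x [n [c [v [c0 c1 Av xE]]]]; rewrite (pairing_comb _ xE).
rewrite -[m]mul1r -c1 mulr_suml; apply: ler_sum => k _.
by rewrite ler_wpM2l ?Am.
Qed.

Lemma convex_hull_fin I (T : finType) (A : set (I -> R)) (c : T -> R)
    (v : T -> I -> R) (x : I -> R) :
  (forall k, 0 <= c k) -> \sum_k c k = 1 -> (forall k, A (v k)) ->
  (forall i, x i = \sum_k c k * v k i) -> convex_hull A x.
Proof.
move=> c0 c1 Av xE; have bijT := onW_bij xpredT (@enum_val_bij T).
exists #|T|, (c \o enum_val), (v \o enum_val); split=> //=.
  by rewrite -c1 [RHS](reindex _ bijT).
by move=> i; rewrite xE (reindex _ bijT).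
Qed.

(** Points of positive weight in a convex combination on a supporting
    hyperplane lie on it too; the others are replaced by one of these. *)
Lemma convex_hull_face I (A : set (I -> R)) y m x :
  (forall a, A a -> pairing y a <= m) ->
  convex_hull A x -> pairing y x = m ->
  convex_hull [set a | A a /\ pairing y a = m] x.
Proof.
move=> Am [n [c [v [c0 c1 Av xE]]]] xm.
have gap k : c k * (m - pairing y (v k)) = 0.
  have gap_ge0 l : true -> 0 <= c l * (m - pairing y (v l)).
    by move=> _; rewrite mulr_ge0 // subr_ge0 Am.
  have gap0 : \sum_l c l * (m - pairing y (v l)) = 0.
    under eq_bigr do rewrite mulrBr.
    by rewrite sumrB -mulr_suml c1 mul1r -(pairing_comb _ xE) xm subrr.
  by have /eqP := gap0; rewrite psumr_eq0 // => /allP/(_ k); rewrite mem_index_enum => /(_ isT)/eqP.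
have tight k : c k != 0 -> pairing y (v k) = m.
  by move=> ck; have /eqP := gap k; rewrite mulf_eq0 (negPf ck) subr_eq0 => /eqP.
have [k0 ck0] : exists k, c k != 0.
  apply: contrapT => /forallNP c_eq0; suff : 1 = 0 :> R by apply/eqP/oner_neq0.
  by rewrite -c1 big1 // => k _; have /negP := c_eq0 k; rewrite negbK => /eqP.
exists n, c, (fun k => if c k == 0 then v k0 else v k); split=> // [k|i] /=.
  by case: ifPn => [_|/tight]; split => //; apply: tight.
by rewrite xE; apply: eq_bigr => k _; case: eqP => // ->; rewrite !mul0r.
Qed.

(** With a common number of points, several convex combinations can be indexed
    by functions into one ordinal. *)
Lemma convex_hull_pad I (A : set (I -> R)) x : convex_hull A x ->
  exists n, forall N, (n <= N)%N -> exists (c : nat -> R) (v : nat -> I -> R),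
    [/\ forall j, 0 <= c j, \sum_(j < N) c j = 1, forall j, A (v j)
      & forall i, x i = \sum_(j < N) c j * v j i].
Proof.
case=> -[|n] [c [v [c0 c1 Av xE]]].
  by have := oner_neq0 R; rewrite -c1 big_ord0 eqxx.
exists n.+1 => N le_nN.
have padE (g : 'I_n.+1 -> R) :
    \sum_(j < N) (if (j < n.+1)%N then g (inord j) else 0) = \sum_k g k.
  rewrite -big_mkcond -(big_ord_widen N (fun j => g (inord j))) //.
  by apply: eq_bigr => j _; rewrite inord_val.
(* The added indices have weight 0, and [inord] sends them to some vector of [A]. *)
exists (fun j => if (j < n.+1)%N then c (inord j) else 0), (fun j => v (inord j)).
split=> [j||j|i] //; first by case: ifP.
  by rewrite padE.
rewrite xE -(padE (fun j => c j * v j i)); apply: eq_bigr => j _.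
by case: ifP => // _; rewrite mul0r.
Qed.

(** Mixing is taking the product of polytopes: the coordinates labeled [l] are
    those of the [l]-th point.  The weight of a mixed vertex is the product of
    the weights of its components. *)
Lemma convex_hull_mix I L (f : I -> L) (A : L -> set (I -> R))
    (x : L -> I -> R) : (forall l, convex_hull (A l) (x l)) ->
  convex_hull [set a | exists2 F : L -> I -> R, forall l, A l (F l)
                                              & forall i, a i = F (f i) i]
    (fun i => x (f i) i).
Proof.
move=> hx; have /choice[n hn] := fun l => convex_hull_pad (hx l).
pose N := (\max_l n l)%N; have le_nN l : (n l <= N)%N by exact: leq_bigmax.
have /choice[c hc] := fun l => hn l N (le_nN l).
have /choice[v hv] := hc.
have c0 l : forall j, 0 <= c l j by have [] := hv l.
have c1 l : \sum_(j < N) c l j = 1 by have [] := hv l.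
have Av l : forall j, A l (v l j) by have [] := hv l.
have xE l : forall i, x l i = \sum_(j < N) c l j * v l j i by have [] := hv l.
apply: (@convex_hull_fin _ {ffun L -> 'I_N} _
  (fun h => \prod_l c l (h l)) (fun h i => v (f i) (h (f i)) i)).
- by move=> h; apply: prodr_ge0.
- rewrite -(bigA_distr_bigA (fun l (j : 'I_N) => c l j)) /=.
  by rewrite big1.
- by move=> h; exists (fun l => v l (h l)).
move=> i; pose w l (j : 'I_N) := if l == f i then v l j i else 1.
transitivity (\prod_l \sum_(j < N) c l j * w l j).
  rewrite (bigD1 (f i)) //= [X in _ * X]big1 ?mulr1; last first.
    move=> l /negPf l_fi; rewrite -(c1 l); apply: eq_bigr => j _.
    by rewrite /w l_fi mulr1.
  by rewrite xE; apply: eq_bigr => j _; rewrite /w eqxx.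
rewrite bigA_distr_bigA; apply: eq_bigr => h _ /=; rewrite big_split; congr (_ * _).
rewrite (bigD1 (f i)) //= big1 ?mulr1 /w ?eqxx //.
by move=> l /negPf->.
Qed.

Lemma max_face_tight I (p : set (I -> R)) y m :
  (forall x, p x -> pairing y x <= m) -> (exists2 x, p x & pairing y x = m) ->
  max_face p y = [set x | p x /\ pairing y x = m].
Proof.
move=> pm [x0 px0 x0m]; apply/seteqP; split=> x [px xm]; split=> //.
  by apply/eqP; rewrite eq_le pm //= -x0m xm.
by move=> z pz; rewrite xm pm.
Qed.

Lemma finite_argmax I (A : set (I -> R)) (g : (I -> R) -> R) :
  finite_set A -> A !=set0 -> exists2 a, A a & forall b, A b -> g b <= g a.
Proof.
move=> /finite_seqP[s ->]; elim: s => [[a]|a s IH _] //=.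
have [-> | s_n0] := eqVneq s [::].
  by exists a => [|b]; rewrite /= inE // => /eqP->.
have /IH[b sb bmax] : [set` s] !=set0.
  by case: s s_n0 {IH} => // b s _; exists b; rewrite /= inE eqxx.
have [ab | /ltW ba] := lerP (g a) (g b).
  exists b => [|c] /=; rewrite inE; first by apply/orP; right.
  by case/orP => [/eqP->|/bmax].
exists a => [|c] /=; rewrite inE ?eqxx //.
by case/orP => [/eqP->|/bmax/le_trans->].
Qed.

Lemma max_face_nonempty I (p : set (I -> R)) y :
  nonempty_polytope p -> max_face p y !=set0.
Proof.
move=> [A [finA A0 ->]]; have [a Aa amax] := finite_argmax (pairing y) finA A0.
exists a; split; first exact: sub_convex_hull.
by move=> z; apply: convex_hull_le.
Qed.

(** A small perturbation of [u] in the direction [v] selects, within the face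
    of [u], the face of [v].  Let [m] be the maximum of [u] and [m2] that of
    [v] on the face of [u].  The finitely many vertices satisfy
    [u + t0 v <= m + t0 m2] for some [t0]; for [0 < t < t0] the functional
    [u + t v] is a proper convex combination of [u] and [u + t0 v], so it is
    at most [m + t m2], with equality only where both bounds are attained. *)
Lemma max_face_perturb I (p : set (I -> R)) u v : nonempty_polytope p ->
  exists2 t0, 0 < t0 & forall t, 0 < t < t0 ->
    max_face p (fun i => u i + t * v i) = max_face (max_face p u) v.
Proof.
move=> [A [finA A0 pE]].
have [a Aa amax] := finite_argmax (pairing u) finA A0.
set m := pairing u a in amax.
have finA' : finite_set [set b | A b /\ pairing u b = m].
  by apply: sub_finite_set finA => b [].
have [|a2 [Aa2 ua2] a2max] := finite_argmax (pairing v) finA'; first by exists a.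
set m2 := pairing v a2 in a2max.
have [t0 t0_gt0 t0P] : exists2 t0, 0 < t0 &
    forall b, A b -> pairing u b + t0 * pairing v b <= m + t0 * m2.
  (* For the induction on the vertices the bound is needed for all small [t]. *)
  suff [t0 t0_gt0 t0P] : exists2 t0, 0 < t0 & forall b, A b ->
      forall t, 0 < t <= t0 -> pairing u b + t * pairing v b <= m + t * m2.
    by exists t0 => // b Ab; apply: t0P; rewrite // t0_gt0 lexx.
  have [s As] : exists s : seq (I -> R), A = [set` s] by apply/finite_seqP.
  suff: (forall b, b \in s -> A b) -> exists2 t0, 0 < t0 & forall b, b \in s ->
      forall t, 0 < t <= t0 -> pairing u b + t * pairing v b <= m + t * m2.
    by case=> [b|t0 ? t0P]; [|exists t0 => // b]; rewrite As //; apply: t0P.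
  elim: s {As} => [_|b s IH sA]; first by exists 1.
  have [|t0 t0_gt0 t0P] := IH.
    by move=> c cs; apply: sA; rewrite inE cs orbT.
  have [t1 t1_gt0 t1P] : exists2 t1, 0 < t1 & forall t, 0 < t <= t1 ->
      pairing u b + t * pairing v b <= m + t * m2.
    have Ab := sA b (mem_head _ _).
    have := amax b Ab; rewrite le_eqVlt => /orP[/eqP ub|ub].
      exists 1 => // t /andP[t_gt0 _].
      by rewrite ub lerD2l ler_wpM2l ?(ltW t_gt0) // a2max.
    pose d := `|pairing v b - m2| + 1.
    have d_gt0 : 0 < d by rewrite ltr_wpDl.
    exists ((m - pairing u b) / d); first by rewrite divr_gt0 ?subr_gt0.
    move=> t /andP[t_gt0]; rewrite ler_pdivlMr // => td.
    have : t * (pairing v b - m2) <= t * d.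
      rewrite ler_wpM2l ?(ltW t_gt0) // (le_trans (ler_norm _)) //.
      by rewrite lerDl ler01.
    by move: td; lra.
  exists (Num.min t0 t1); first by rewrite lt_min t0_gt0.
  move=> c /=; rewrite inE => /orP[/eqP-> | cs] t; rewrite le_min => /and3P[t_gt0 tt0 tt1].
    by apply: t1P; rewrite t_gt0.
  by apply: t0P => //; rewrite t_gt0.
exists t0 => // t /andP[t_gt0 tt0].
have um x : p x -> pairing u x <= m.
  by rewrite pE; apply: convex_hull_le.
have um2 x : p x -> pairing u x + t0 * pairing v x <= m + t0 * m2.
  rewrite pE -pairingDZ; apply: convex_hull_le => b Ab.
  by rewrite pairingDZ t0P.
have sp : A `<=` p by rewrite pE; apply: sub_convex_hull.
have Fu : max_face p u = [set x | p x /\ pairing u x = m].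
  by apply: max_face_tight => //; exists a => //; apply: sp.
have t_frac : 0 < t / t0 < 1 by rewrite divr_gt0 //= ltr_pdivrMr // mul1r.
have utE x : pairing u x + t * pairing v x = (1 - t / t0) * pairing u x
    + t / t0 * (pairing u x + t0 * pairing v x).
  by field; rewrite gt_eqF.
have mE : m + t * m2 = (1 - t / t0) * m + t / t0 * (m + t0 * m2).
  by field; rewrite gt_eqF.
rewrite (@max_face_tight _ p _ (m + t * m2)); first last.
- by exists a2; [exact: sp | rewrite pairingDZ ua2].
- move=> x px; rewrite pairingDZ utE mE lerD // ler_wpM2l ?um ?um2 //; lra.
rewrite Fu (@max_face_tight _ _ _ m2); first last.
- by exists a2 => //; split => //; apply: sp.
- move=> x [px xm]; have := um2 x px.
  by rewrite xm lerD2l ler_pM2l.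
apply/seteqP; split=> x /=.
  rewrite pairingDZ utE mE => -[px xm].
  have {}xm : (1 - t / t0) * (m - pairing u x) +
     t / t0 * (m + t0 * m2 - (pairing u x + t0 * pairing v x)) = 0.
    by move: xm; lra.
  have nn1 : 0 <= (1 - t / t0) * (m - pairing u x).
    by rewrite mulr_ge0 ?subr_ge0 ?um //; lra.
  have nn2 : 0 <= t / t0 * (m + t0 * m2 - (pairing u x + t0 * pairing v x)).
    by rewrite mulr_ge0 ?subr_ge0 ?um2 //; lra.
  have /andP[] : ((1 - t / t0) * (m - pairing u x) == 0) &&
      (t / t0 * (m + t0 * m2 - (pairing u x + t0 * pairing v x)) == 0).
    by rewrite -paddr_eq0 // xm.
  have nz1 : (1 - t / t0 == 0) = false by apply: gt_eqF; lra.
  have nz2 : (t / t0 == 0) = false by apply: gt_eqF; lra.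
  rewrite (mulf_eq0 (1 - _)) (mulf_eq0 (t / t0)) nz1 nz2 /= !subr_eq0.
  move=> /eqP <- /eqP /addrI /mulfI xm2.
  by split=> //; apply/esym/xm2; rewrite gt_eqF.
by case=> -[px xu xv]; rewrite pairingDZ xu xv.
Qed.

End Faces.

(** * Normal fans as preorders, and products of permutahedra *)

Section Fans.
Context (R : realType).
Implicit Types (I J L : finType).

Definition face_le I (p : set (I -> R)) (y y' : I -> R) : Prop :=
  max_face p y `<=` max_face p y'.

(** The cone attached to [y] is the smallest cone of the fan that contains [y],
    so the fan determines the preorder. *)
Lemma normally_equivalentP I (p q : set (I -> R)) :
  normally_equivalent p q <-> forall y y', face_le p y y' <-> face_le q y y'.
Proof.
rewrite /normally_equivalent /normal_fan; split=> [fans|pq]; last first.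
  suff coneE y : normal_cone p (max_face p y) = normal_cone q (max_face q y).
    by apply/seteqP; split=> _ [y _ <-]; exists y; rewrite ?coneE.
  by apply/seteqP; split=> y' /=; have [] := pq y y'.
have sub_fans (p1 p2 : set (I -> R)) : normal_fan p1 `<=` normal_fan p2 ->
    forall y y', face_le p2 y y' -> face_le p1 y y'.
  move=> p12 y y' le2; have [|w _ wE] := p12 (normal_cone p1 (max_face p1 y)).
    by exists y.
  have coneE z : face_le p1 y z <-> face_le p2 w z.
    by change (normal_cone p1 (max_face p1 y) z <-> face_le p2 w z); rewrite -wE.
  by apply/coneE; apply: subset_trans le2; apply/coneE.
by move=> y y'; split; apply: sub_fans; rewrite /normal_fan fans.
Qed.

Definition braid_le I (L : eqType) (f : I -> L) (y y' : I -> R) : Prop :=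
  forall i j, f i = f j -> y i <= y j -> y' i <= y' j.

(** The vertices of the product of the permutahedra on the fibers of [f].
    Describing each entry as its rank in its block avoids bijections with
    initial segments of the integers. *)
Definition block_vertex I (L : eqType) (f : I -> L) (a : I -> R) : Prop :=
  (forall i j, f i = f j -> a i = a j -> i = j) /\
  forall i, a i = (1 + #|[set j | (f j == f i) && (a j < a i)]%SET|)%:R.

Lemma card_ord_lt n (k : 'I_n) : #|[set m : 'I_n | (m < k)%N]%SET| = k.
Proof.
rewrite -sum1dep_card -(big_ord_widen _ (fun=> 1%N)) ?sum1_card ?card_ord //.
exact: ltnW.
Qed.

Lemma permutation_vertexP J (b : J -> R) :
  range b = [set n%:R | n in [set n | 1 <= n <= #|J|]%N] <->
  injective b /\ forall i, b i = (1 + #|[set j | b j < b i]%SET|)%:R.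
Proof.
split=> [rb|[b_inj bE]].
  have /choice[c bE] : forall i, exists m : 'I_#|J|, b i = m.+1%:R.
    move=> i; have : range b (b i) by exists i.
    by rewrite rb => -[[|n] //= n_lt <-]; exists (Ordinal n_lt).
  have c_inj : injective c.
    suff cT : (c @: [set: J])%SET = [set: 'I_#|J|]%SET.
      have /imset_injP cI : #|(c @: [set: J])%SET| == #|[set: J]%SET|.
        by rewrite cT !cardsT card_ord.
      by move=> i j; apply: cI; rewrite inE.
    apply/setP => m; rewrite inE; apply/imsetP.
    have [i _ bi] : range b m.+1%:R by rewrite rb; exists m.+1 => //=.
    exists i => //; apply/val_inj; move/eqP: bi.
    by rewrite bE eqr_nat eqSS => /eqP.
  split=> [i j|i].
    by rewrite !bE => /eqP; rewrite eqr_nat eqSS => /eqP/val_inj/c_inj.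
  rewrite bE add1n -[in LHS](card_ord_lt (c i)) -(card_imset _ c_inj).
  congr (_.+1%:R); apply: eq_card => m; rewrite inE.
  have [c' cK c'K] : bijective c by apply: inj_card_bij; rewrite ?card_ord.
  apply/idP/imsetP => [m_lt|[j + ->]]; last by rewrite inE !bE ltr_nat.
  by exists (c' m); rewrite ?inE ?bE ?c'K // ltr_nat.
pose c i : nat := #|[set j | b j < b i]%SET|.
have {}bE i : b i = (1 + c i)%:R by exact: bE.
have c_lt i : (c i < #|J|)%N.
  rewrite -cardsT; apply: proper_card; apply/properP; split.
    exact: finset.subsetT.
  by exists i; rewrite inE // ltxx.
have c_inj : injective (fun i => Ordinal (c_lt i)).
  by move=> i j [cij]; apply: b_inj; rewrite !bE cij.
have [c' cK c'K] : bijective (fun i => Ordinal (c_lt i)).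
  by apply: inj_card_bij; rewrite ?card_ord.
apply/seteqP; split=> [_ [i _ <-]|_ [[|n] //= n_le <-]].
  by exists (c i).+1; [exact: c_lt | rewrite bE add1n].
exists (c' (Ordinal n_le)) => //.
by rewrite bE add1n; have /(congr1 val) /= -> := c'K (Ordinal n_le).
Qed.

Lemma mem_preim_partition I L (f : I -> L) (B : {set I}) :
  B \in preim_partition f [set: I]%SET <-> exists i, B = fiber f (f i).
Proof.
split=> [/imsetP[i _ ->]|[i ->]].
  by exists i; apply/setP => j; rewrite !inE eq_sym.
by apply/imsetP; exists i => //; apply/setP => j; rewrite !inE eq_sym.
Qed.

Lemma block_vertexP I L (f : I -> L) (a : I -> R) :
  block_vertex f a <->
  forall B, B \in preim_partition f [set: I]%SET ->
    range (restr B a) = [set n%:R | n in [set n | 1 <= n <= #|{: sub B}|]%N].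
Proof.
have cardE (B : {set I}) i (iB : i \in B) : B = fiber f (f i) ->
    #|[set j : sub B | restr B a j < restr B a (exist _ i iB)]%SET|
    = #|[set j | (f j == f i) && (a j < a i)]%SET|.
  move=> BE; rewrite -(card_imset _ val_inj); apply: eq_card => j.
  apply/imsetP/idP => [[[l lB]]|]; rewrite !inE /restr /=.
    by move=> + ->; move: (lB); rewrite {1}BE inE => ->.
  case/andP=> fj aj; have jB : j \in B by rewrite BE inE.
  by exists (exist _ j jB); rewrite ?inE.
split=> [[a_inj aE] _ /mem_preim_partition[i ->]|aP].
  apply/permutation_vertexP; split=> [[j jB] [l lB]|[j jB]] /=.
    rewrite /restr /= => ajl; apply: val_inj; apply: a_inj ajl => /=.
    by move: jB lB; rewrite !inE => /eqP-> /eqP->.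
  rewrite (cardE _ j jB) ?/restr /= -?aE //.
  by move: jB; rewrite inE => /eqP->.
have blockP i : let B := fiber f (f i) in injective (restr B a) /\
    forall j, restr B a j = (1 + #|[set l | restr B a l < restr B a j]%SET|)%:R.
  move=> B; apply: (permutation_vertexP (restr B a)).1; apply: aP.
  by apply/mem_preim_partition; exists i.
split=> [i j fij aij|i]; have [a_inj aE] := blockP i.
  have iB : i \in fiber f (f i) by rewrite inE.
  have jB : j \in fiber f (f i) by rewrite inE fij.
  by have /(congr1 val) := a_inj (exist _ i iB) (exist _ j jB) aij.
have iB : i \in fiber f (f i) by rewrite inE.
by have := aE (exist _ i iB); rewrite (cardE _ i iB).
Qed.

(** The representative of a class: every product of permutahedra arises from
    some labeling, and labels restrict and glue more easily than blocks. *)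
Definition block_perm I L (f : I -> L) : set (I -> R) :=
  perm_prod R (preim_partition f [set: I]%SET).

(** A product of convex hulls is the hull of the product of the vertex sets:
    this is [convex_hull_mix], with the blocks as labels. *)
Lemma block_permE I L (f : I -> L) :
  block_perm f = convex_hull (block_vertex f).
Proof.
set P := preim_partition f [set: I]%SET.
pose A (B : {set I}) : set (I -> R) := [set a | B \in P ->
  range (restr B a) = [set n%:R | n in [set n | 1 <= n <= #|{: sub B}|]%N]].
apply/seteqP; split=> x.
  move=> xP; have hx B : convex_hull (A B) x.
    have [BP|BP] := boolP (B \in P); last first.
      by apply: sub_convex_hull => BP'; rewrite BP' in BP.
    have [n [c [v [c0 c1 Av xE]]]] := xP B BP.
    (* Outside [B] the vertices are given the coordinates of [x], which the
       combination reproduces because the weights add up to 1. *)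
    exists n, c, (fun l i => if insub i is Some j then v l j else x i).
    split=> // [l _|i].
      by rewrite -(Av l); congr image; apply/funext => j; rewrite /restr valK.
    case: insubP => [j _ <-|_]; first by rewrite -xE.
    by rewrite -mulr_suml c1 mul1r.
  have := @convex_hull_mix R I _ (fun i => fiber f (f i)) A (fun=> x) hx.
  apply: convex_hullS => a [F AF aE]; apply/block_vertexP => B BP.
  rewrite -(AF B BP); congr image; apply/funext => -[j jB].
  rewrite /restr /= aE; congr (F _ j).
  move: jB; have /mem_preim_partition[i ->] := BP.
  by rewrite inE => /eqP->.
move=> [n [c [v [c0 c1 Av xE]]]] B BP.
exists n, c, (fun l => restr B (v l)); split=> // [l|j]; last exact: xE.
by have /block_vertexP/(_ B BP) := Av l.
Qed.

End Fans.

(** * The normal fan of a product of permutahedra *)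

Section BlockPermutahedra.
Context (R : realType).
Implicit Types (I J L : finType).

Definition sorted_by I (L : eqType) (f : I -> L) (a y : I -> R) : Prop :=
  forall i j, f i = f j -> a i < a j -> y i <= y j.

(** The support function of [block_perm f].  It is that of the zonotope
    [sum_i e_i + sum_(i, j) [e_i, e_j]], the second sum over unordered pairs in
    a block; each pair is counted twice below, hence the factor [1 / 2]. *)
Definition block_support I (L : eqType) (f : I -> L) (y : I -> R) : R :=
  \sum_i y i + 2^-1 * \sum_i \sum_j
    (if (f j == f i) && (j != i) then Num.max (y i) (y j) else 0).

(** The entry of [a] at [i] counts the [j] in the block of [i] with
    [a j <= a i].  So the pairing adds up [y i] over all [i], and over all pairs
    in a block the value of [y] at the point where [a] is larger. *)
Lemma block_vertex_gap I L (f : I -> L) (a y : I -> R) : block_vertex f a ->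
  block_support f y - pairing y a =
  2^-1 * \sum_i \sum_j (if (f j == f i) && (j != i)
    then Num.max (y i) (y j) - (if a j < a i then y i else y j) else 0).
Proof.
move=> [a_inj aE].
pose G i j := if (f j == f i) && (a j < a i) then y i else 0.
have -> : pairing y a = \sum_i y i + \sum_i \sum_j G i j.
  rewrite /pairing -big_split; apply: eq_bigr => i _ /=.
  rewrite aE natrD mulrDr mulr1 -sum1_card natr_sum mulr_sumr big_mkcond.
  by congr (_ + _); apply: eq_bigr => j _; rewrite inE /G mulr1.
have -> : \sum_i \sum_j G i j = 2^-1 * \sum_i \sum_j (G i j + G j i).
  under [X in _ * X]eq_bigr do rewrite big_split /=.
  rewrite big_split /= [X in _ * (_ + X)]exchange_big /=.
  by set s := \sum_i _; lra.
rewrite opprD addrACA subrr add0r -mulrBr; congr (_ * _).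
rewrite -sumrB; apply: eq_bigr => i _; rewrite -sumrB; apply: eq_bigr => j _.
rewrite /G (eq_sym (f i)); case: (f j =P f i) => [fji|_] /=; last first.
  by rewrite addr0 subr0.
have [->|ji] := eqVneq j i; first by rewrite ltxx addr0 subr0.
case: ltgtP => [_|_|aji] /=; rewrite ?addr0 ?add0r //.
by rewrite (a_inj j i fji aji) eqxx in ji.
Qed.

Lemma max_gap_ge0 (b : bool) (u v : R) :
  0 <= Num.max u v - (if b then u else v).
Proof. by rewrite subr_ge0 le_max; case: b; rewrite lexx ?orbT. Qed.

Lemma block_vertex_le I L (f : I -> L) (a y : I -> R) :
  block_vertex f a -> pairing y a <= block_support f y.
Proof.
move=> av; rewrite -subr_ge0 (block_vertex_gap y av) mulr_ge0 ?invr_ge0 //.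
apply: sumr_ge0 => i _; apply: sumr_ge0 => j _.
by case: ifP => // _; apply: max_gap_ge0.
Qed.

(** Each pair in a block has a nonnegative gap, which vanishes exactly when [a]
    and [y] do not order the pair oppositely. *)
Lemma block_vertex_eq I L (f : I -> L) (a y : I -> R) : block_vertex f a ->
  pairing y a = block_support f y <-> sorted_by f a y.
Proof.
move=> av; have gapE := block_vertex_gap y av.
pose T i j := (if (f j == f i) && (j != i)
    then Num.max (y i) (y j) - (if a j < a i then y i else y j) else 0).
rewrite -[RHS]/(2^-1 * \sum_i \sum_j T i j) in gapE.
have T0 i j : 0 <= T i j by rewrite /T; case: ifP => // _; apply: max_gap_ge0.
have TP : pairing y a = block_support f y <-> forall i j, T i j = 0.
  split=> [yaE i j|T_eq0]; last first.
    apply/esym/eqP; rewrite -subr_eq0 gapE big1 ?mulr0 // => i _.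
    by rewrite big1 // => j _; apply: T_eq0.
  move: gapE; rewrite yaE subrr => /esym/eqP.
  rewrite mulf_eq0 invr_eq0 pnatr_eq0 /= psumr_eq0 => [|l _]; last by apply: sumr_ge0 => ? _.
  move=> /allP/(_ i); rewrite mem_index_enum => /(_ isT) /=.
  by rewrite psumr_eq0 // => /allP/(_ j); rewrite mem_index_enum => /(_ isT)/eqP.
apply: (iff_trans TP); split=> [T_eq0 i j fij aij|a_sorted i j].
  have := T_eq0 i j; rewrite /T fij eqxx /= ltNge (ltW aij) /=.
  have -> : j != i by apply: contraTneq aij => ->; rewrite ltxx.
  by move/eqP; rewrite subr_eq0 => /eqP <-; rewrite le_max lexx.
rewrite /T; case: ifP => // /andP[/eqP fji ji].
case: ltgtP => [aji|aij|aji]; last first.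
- by case/eqP: ji; apply: av.1 fji aji.
- by rewrite max_r ?subrr // a_sorted.
- by rewrite max_l ?subrr // a_sorted.
Qed.

(** The vertex given by a total order of [I]; vertices sorted by a given
    functional are obtained in this way. *)
Definition key_vertex I (L : eqType) (f : I -> L) d (T : orderType d)
    (key : I -> T) : I -> R :=
  fun i => (1 + #|[set j | (f j == f i) && (key j < key i)%O]%SET|)%:R.

Lemma key_vertex_lt I L (f : I -> L) d (T : orderType d) (key : I -> T) i j :
  f i = f j -> (key_vertex f key i < key_vertex f key j) = (key i < key j)%O.
Proof.
move=> fij; pose lower i := [set j | (f j == f i) && (key j < key i)%O]%SET.
have lower_mono i' j' : f i' = f j' -> (key i' < key j')%O ->
    (#|lower i'| < #|lower j'|)%N.
  move=> fij' kij; apply: proper_card; apply/properP; split.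
    apply/fintype.subsetP => l; rewrite !inE => /andP[/eqP-> kl].
    by rewrite fij' eqxx (lt_trans kl).
  by exists i'; rewrite !inE ?fij' ?eqxx ?ltxx.
rewrite ltr_nat ltn_add2l -/(lower i) -/(lower j).
apply/idP/idP => [|/lower_mono->//].
have [//|kji|kij] := ltgtP (key i) (key j); first by rewrite ltnNge ltnW // lower_mono.
suff -> : lower i = lower j by rewrite ltnn.
by apply/setP => l; rewrite !inE fij kij.
Qed.

Lemma key_vertexP I L (f : I -> L) d (T : orderType d) (key : I -> T) :
  injective key -> block_vertex f (key_vertex f key).
Proof.
move=> key_inj; split=> [i j fij aij|i].
  apply: key_inj; apply/eqP; have := ltxx (key_vertex f key i).
  rewrite {2}aij (key_vertex_lt _ fij); have := ltxx (key_vertex f key i).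
  by rewrite {1}aij (key_vertex_lt _ (esym fij)); case: ltgtP.
rewrite {1}/key_vertex; congr (_ + _)%:R; apply: eq_card => j; rewrite !inE.
by case: (f j =P f i) => //= fji; rewrite key_vertex_lt.
Qed.

(** Sorting [y], with ties broken so that [j0] comes last among the points with
    the same value. *)
Lemma exists_sorted_vertex I L (f : I -> L) (y : I -> R) (i0 j0 : I) :
  exists a, [/\ block_vertex f a, sorted_by f a y &
    f i0 = f j0 -> y i0 <= y j0 -> i0 != j0 -> a i0 < a j0].
Proof.
(* The tie-breaking rank of [j0] exceeds all values of [enum_rank]. *)
pose r i := if i == j0 then #|I| else enum_rank i : nat.
have r_inj : injective r.
  have rank_lt (i : I) : (enum_rank i < #|I|)%N by exact: ltn_ord.
  move=> i j; rewrite /r; case: eqP => [->|_]; case: eqP => [->|_] //.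
  - by move=> IE; have := rank_lt j; rewrite -IE ltnn.
  - by move=> IE; have := rank_lt i; rewrite IE ltnn.
  - by move/val_inj/enum_rank_inj.
pose key i : (R *l nat)%type := (y i, r i).
have key_inj : injective key by move=> i j [_ /r_inj].
exists (key_vertex f key); split; first exact: key_vertexP.
  move=> i j fij; rewrite key_vertex_lt // Order.ProdLexiOrder.ltEprodlexi /=.
  by case/andP.
move=> fij yij ij; rewrite key_vertex_lt // Order.ProdLexiOrder.ltEprodlexi /=.
rewrite yij /=; apply/implyP => _; rewrite /r eqxx (negPf ij).
exact: ltn_ord.
Qed.

Lemma block_perm_max_face I L (f : I -> L) (y : I -> R) :
  max_face (block_perm f) y =
  [set x | block_perm f x /\ pairing y x = block_support f y].
Proof.
apply: max_face_tight; rewrite block_permE.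
  by move=> x; apply: convex_hull_le => a; apply: block_vertex_le.
have [[i _]|I0] := pselect (exists i : I, True).
  have [a [av ay _]] := exists_sorted_vertex f y i i.
  by exists a; [apply: sub_convex_hull | apply/block_vertex_eq].
have av : block_vertex f (fun=> 0 : R).
  by split=> i; case: I0; exists i.
exists (fun=> 0); first exact: sub_convex_hull.
by apply/block_vertex_eq => // i; case: I0; exists i.
Qed.

(** The face maximizing [y] is spanned by the vertices sorted by [y].  If [y']
    is weakly ordered like [y] in each block, these vertices are sorted by [y']
    too.  Conversely, when [y i <= y j] some vertex sorted by [y] is smaller at
    [i] than at [j], and being sorted by [y'] forces [y' i <= y' j]. *)
Lemma block_perm_face_le I L (f : I -> L) (y y' : I -> R) :
  face_le (block_perm f) y y' <-> braid_le f y y'.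
Proof.
rewrite /face_le !block_perm_max_face; split=> [le_yy i j fij yij|yy' x].
  have [->|ij] := eqVneq i j; first by rewrite lexx.
  have [a [av ay aij]] := exists_sorted_vertex f y i j.
  have [|_ /block_vertex_eq-/(_ av) ay'] := le_yy a; last exact/ay'/aij.
  by split; [rewrite block_permE; apply: sub_convex_hull | apply/block_vertex_eq].
case=> px; have := px; rewrite {1}block_permE => hx xm; split=> //.
have [n [c [v [c0 c1 Av xE]]]] :=
  convex_hull_face (fun a => @block_vertex_le _ _ f a y) hx xm.
rewrite (pairing_comb _ xE) -[RHS]mul1r -c1 mulr_suml; apply: eq_bigr => l _.
congr (_ * _); have [lv] := Av l; move/(block_vertex_eq _ lv) => lm.
by apply/block_vertex_eq => // i j fij lij; apply: yy' => //; apply: lm.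
Qed.

Lemma block_perm_polytope I L (f : I -> L) : nonempty_polytope (@block_perm R I L f).
Proof.
exists (block_vertex f); split; last exact: block_permE.
  apply: (@sub_finite_set _ _ (range (fun (h : {ffun I -> 'I_#|I|.+2}) (i : I) =>
    (h i)%:R : R))); last by apply: finite_image; apply: finite_finset.
  move=> a [_ aE].
  exists [ffun i => inord (1 + #|[set j | (f j == f i) && (a j < a i)%R]%SET|)] => //.
  by apply/funext => i; rewrite ffunE [RHS]aE inordK // add1n !ltnS max_card.
exists (key_vertex f (fun i => enum_rank i : nat)).
by apply: key_vertexP => i j /val_inj/enum_rank_inj.
Qed.

Lemma block_perm_gen I L (f : I -> L) : gen_permutahedron (@block_perm R I L f).
Proof.
split; first exact: block_perm_polytope.
split=> [_ [y _ <-]|].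
  exists (normal_cone (block_perm f) (max_face (block_perm f) y)); first by exists y.
  by move=> z yz; apply/block_perm_face_le => i j _; apply: yz.
apply/seteqP; split=> y _; [exists (braid_cone y) | ] => //; first by exists y.
by exists (normal_cone (block_perm f) (max_face (block_perm f) y)) => //; exists y.
Qed.

(** A vertex maximizing the indicator of [S] puts the top values of each block
    in [S].  Hence its parts in [S] and outside can be exchanged independently
    with those of another such vertex. *)
Lemma block_vertex_mix I L (f : I -> L) (S : {set I}) (a1 a2 : I -> R) :
  block_vertex f a1 -> block_vertex f a2 ->
  sorted_by f a1 (indicator R S) -> sorted_by f a2 (indicator R S) ->
  let a i := if i \in S then a1 i else a2 i in
  block_vertex f a /\ sorted_by f a (indicator R S).
Proof.
move=> av1 av2 as1 as2 a.
have top b i j : block_vertex f b -> sorted_by f b (indicator R S) ->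
    i \in S -> j \notin S -> f j = f i -> b j < b i.
  move=> bv bs iS jS fji; rewrite ltNge le_eqVlt; apply/negP => /orP[/eqP bij|].
    by move: iS; rewrite (bv.1 i j (esym fji) bij) (negPf jS).
  by move/(bs i j (esym fji)); rewrite /indicator iS (negPf jS) ler10.
(* The entries of [a2] outside [S] are at most the number of points of the block
   outside [S], and those of [a1] in [S] exceed it. *)
have sep i j : i \in S -> j \notin S -> f j = f i -> a2 j < a1 i.
  move=> iS jS fji; rewrite av1.2 av2.2 ltr_nat ltn_add2l.
  apply: (@leq_trans #|[set l | (f l == f i) && (l \notin S)]%SET|).
    apply: proper_card; apply/properP; split.
      apply/fintype.subsetP => l; rewrite !inE fji => /andP[/eqP fl alj].
      rewrite fl eqxx /=; apply/negP => lS; move: alj.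
      by apply/negP; rewrite -leNgt ltW // top // fji fl.
    by exists j; rewrite !inE ?fji ?eqxx //= ltxx.
  apply: subset_leq_card; apply/fintype.subsetP => l; rewrite !inE => /andP[/eqP fl lS].
  by rewrite fl eqxx /=; apply: top => //.
have lt_in i j : i \in S -> f j = f i -> (a j < a i) = (a1 j < a1 i).
  move=> iS fji; rewrite /a iS; case: (boolP (j \in S)) => // jS.
  by rewrite (sep i j) // top.
have lt_out i j : i \notin S -> f j = f i -> (a j < a i) = (a2 j < a2 i).
  move=> iS fji; rewrite /a (negPf iS); case: (boolP (j \in S)) => // jS.
  by rewrite !ltNge !ltW // ?sep // top.
split; first split=> [i j fij|i].
- rewrite /a; case: (boolP (i \in S)) => iS; case: (boolP (j \in S)) => jS.
  + exact: av1.1.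
  + by move=> aij; have := sep i j iS jS (esym fij); rewrite aij ltxx.
  + by move=> aij; have := sep j i jS iS fij; rewrite aij ltxx.
  + exact: av2.1.
- have [iS|iS] := boolP (i \in S).
    rewrite {1}/a iS av1.2; congr (_ + _)%:R; apply: eq_card => j; rewrite !inE.
    by case: eqP => //= fji; rewrite lt_in.
  rewrite {1}/a (negPf iS) av2.2; congr (_ + _)%:R; apply: eq_card => j; rewrite !inE.
  by case: eqP => //= fji; rewrite lt_out.
move=> i j fij; have [jS|jS] := boolP (j \in S); first by rewrite lt_in //; apply: as1.
by rewrite lt_out //; apply: as2.
Qed.

(** The face maximizing the indicator of [S] is the hull of vertices whose parts
    in [S] and outside can be exchanged, so by [convex_hull_mix], with the two
    sides as labels, it contains every mixture of two of its points. *)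
Lemma block_perm_coprod I L (f : I -> L) (S : {set I}) :
  exists q r, poly_coprod (S := S) (@block_perm R I L f) q r.
Proof.
pose F := max_face (block_perm f) (indicator R S).
pose A : set (I -> R) := [set a | block_vertex f a /\
  pairing (indicator R S) a = block_support f (indicator R S)].
have FA z : F z -> convex_hull A z.
  rewrite /F block_perm_max_face => -[+ zm]; rewrite block_permE => hz.
  exact: convex_hull_face (fun a => @block_vertex_le _ _ f a _) hz zm.
have AF x : convex_hull A x -> F x.
  move=> hx; rewrite /F block_perm_max_face; split.
    by rewrite block_permE; apply: convex_hullS hx => a [].
  case: hx => n [c [v [c0 c1 Av xE]]].
  rewrite (pairing_comb _ xE) -[RHS]mul1r -c1 mulr_suml; apply: eq_bigr => l _.
  by have [_ ->] := Av l.
exists [set restr S z | z in F], [set restr (~: S) z | z in F].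
apply/seteqP; split=> [x [[z Fz zx] [z' Fz' zx']]|x Fx]; last first.
  by split; exists x.
apply: AF; pose xs (b : bool) := if b then z else z'.
have hxs b : convex_hull A (xs b) by case: b; apply: FA.
have -> : x = fun i => xs (i \in S) i.
  apply/funext => i; rewrite /xs; case: (boolP (i \in S)) => iS.
    by have := congr1 (@^~ (exist _ i iS)) zx.
  have iS' : i \in ~: S by rewrite inE.
  by have := congr1 (@^~ (exist _ i iS')) zx'.
apply: convex_hullS (convex_hull_mix (fun i => i \in S) hxs) => a [V AV aE].
have [v1 /(block_vertex_eq _ v1) s1] := AV true.
have [v2 /(block_vertex_eq _ v2) s2] := AV false.
have [av as_] := block_vertex_mix v1 v2 s1 s2.
have -> : a = fun i => if i \in S then V true i else V false i.
  by apply/funext => i; rewrite aE; case: (i \in S).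
by split=> //; apply/block_vertex_eq.
Qed.

End BlockPermutahedra.

(** * The Hopf monoid operations on classes of labelings *)

Section Classes.
Context (R : realType).
Implicit Types (I J L : finType).

Definition label_class I L (f : I -> L) : Pibar R I :=
  to_pibar (nclass (block_perm f)).

Lemma val_label_class I L (f : I -> L) :
  val (label_class f) = nclass (block_perm f).
Proof.
rewrite /label_class /to_pibar val_insubd ifT //; apply/mem_set.
exists (preim_partition f [set: I]%SET) => //; exact: preim_partitionP.
Qed.

Lemma nclassE I L (f : I -> L) (p : set (I -> R)) :
  (forall y y', face_le p y y' <-> braid_le f y y') ->
  nclass p = nclass (block_perm f).
Proof.
move=> pf; suff fans : normally_equivalent p (block_perm f).
  by rewrite /nclass /normally_equivalent fans.
apply/normally_equivalentP => y y'; apply: (iff_trans (pf y y')).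
by apply: iff_sym; apply: block_perm_face_le.
Qed.

Lemma label_classP I L (f : I -> L) (p : set (I -> R)) :
  val (label_class f) p <->
  gen_permutahedron p /\ forall y y', face_le p y y' <-> braid_le f y y'.
Proof.
rewrite val_label_class; split=> -[genp]; [move=> /normally_equivalentP pf|move=> pf].
  by split=> // y y'; apply: (iff_trans (pf y y')); apply: block_perm_face_le.
split=> //; apply/normally_equivalentP => y y'; apply: (iff_trans (pf y y')).
by apply: iff_sym; apply: block_perm_face_le.
Qed.

Lemma label_class_mem I L (f : I -> L) : val (label_class f) (block_perm f).
Proof.
by apply/label_classP; split; [apply: block_perm_gen | apply: block_perm_face_le].
Qed.

Lemma label_class_surj I (C : Pibar R I) :
  exists f : I -> {set I}, C = label_class f.
Proof.
have [P partP CE] : is_pibar (val C) by apply/set_mem; exact: (valP C).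
exists (finset.pblock P); apply: val_inj; rewrite CE val_label_class /block_perm.
by rewrite finset.preim_partition_pblock.
Qed.

Lemma eq_label_class I L L' (f : I -> L) (g : I -> L') :
  (forall i j, (f i == f j) = (g i == g j)) -> label_class f = label_class g.
Proof.
move=> fg; rewrite /label_class /block_perm; congr (to_pibar (nclass (perm_prod R _))).
by apply: eq_imset => i; apply/setP => j; rewrite !inE fg.
Qed.

(** The functionals constant on a polytope of the class are those constant on
    each block, so the class determines the blocks. *)
Lemma label_class_kernel I L L' (f : I -> L) (g : I -> L') :
  label_class f = label_class g -> forall i j, (f i == f j) = (g i == g j).
Proof.
move=> fg.
have braidE (y y' : I -> R) : braid_le f y y' <-> braid_le g y y'.
  have /label_classP[_ pf] := label_class_mem f.
  have : val (label_class g) (block_perm f) by rewrite -fg; apply: label_class_mem.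
  by case/label_classP => _ pg; apply: iff_trans (iff_sym (pf y y')) (pg y y').
have sub_kernel (M M' : finType) (u : I -> M) (v : I -> M') :
    (forall y y' : I -> R, braid_le v y y' -> braid_le u y y') ->
    forall i j, u i = u j -> v i = v j.
  (* The functional 0 is below [y] exactly when [y] is constant on blocks. *)
  move=> vu i j uij; pose y (l : I) : R := (v l == v i)%:R.
  have /vu/(_ i j uij) : braid_le v (fun=> 0) y.
    by move=> l l' vl _; rewrite /y vl.
  rewrite /y eqxx => /(_ (lexx _)); case: (v j =P v i) => //.
  by rewrite ler10.
by move=> i j; apply/eqP/eqP; apply: sub_kernel => y y' /braidE.
Qed.

(** The operations are defined with all representatives of the classes at once.
    They give a single class because the preorder of the result is the same for
    all representatives; here [G] is the set of results. *)
Lemma to_pibar_class I L (f : I -> L) (G : set (set (I -> R))) :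
  G !=set0 ->
  (forall q, G q -> forall y y', face_le q y y' <-> braid_le f y y') ->
  to_pibar [set q' | exists2 q, G q & nclass q q'] = label_class f.
Proof.
move=> [q0 Gq0] Gf; rewrite /label_class; congr to_pibar.
apply/seteqP; split=> q' /=; first by case=> q /Gf/nclassE->.
by move=> q'_f; exists q0; rewrite ?(nclassE (Gf _ Gq0)).
Qed.

Lemma pibar_relabel_class I J L (sigma : I -> J) (f : J -> L) :
  bijective sigma ->
  pibar_relabel sigma (label_class (f \o sigma)) = label_class f.
Proof.
move=> bij; have [tau sigmaK tauK] := bij.
have -> : pibar_relabel sigma (label_class (f \o sigma)) = to_pibar [set q' |
    exists2 q, [set poly_relabel sigma p | p in val (label_class (f \o sigma))] q
             & nclass q q'].
  congr to_pibar; apply/seteqP; split=> q'.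
    by case=> p fp pq'; exists (poly_relabel sigma p) => //; exists p.
  by case=> _ [p fp <-] pq'; exists p.
apply: to_pibar_class => [|_ [p /label_classP[_ pf] <-] y y'].
  by exists (poly_relabel sigma (block_perm (f \o sigma))), (block_perm (f \o sigma)) => //;
    apply: label_class_mem.
have pairE (u x : J -> R) : pairing u x = pairing (u \o sigma) (x \o sigma).
  by rewrite /pairing (reindex sigma) //; apply: onW_bij.
have tauE (x : I -> R) : (x \o tau) \o sigma = x.
  by apply/funext => i /=; rewrite sigmaK.
have faceE u x : max_face (poly_relabel sigma p) u x <->
    max_face p (u \o sigma) (x \o sigma).
  split=> -[px ux]; split=> // z pz; last by rewrite !pairE ux.
  by rewrite -pairE -(tauE z) -pairE ux // /poly_relabel /= tauE.
have leE : face_le (poly_relabel sigma p) y y' <->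
    face_le p (y \o sigma) (y' \o sigma).
  split=> le_yy x; last by move=> /faceE/le_yy/faceE.
  by rewrite -(tauE x) => /faceE/le_yy/faceE.
apply: (iff_trans leE); apply: (iff_trans (pf _ _)); split=> yy' i j.
  by have := yy' (tau i) (tau j); rewrite /= !tauK.
exact: yy'.
Qed.

Definition split_sub I (S : {set I}) (i : I) : sub S + sub (~: S) :=
  match decP (@idP (i \in S)) with
  | left iS => inl (exist _ i iS)
  | right iS => inr (exist _ i (etrans (finset.in_setC i S) (introN idP iS)))
  end.

Lemma split_sub_inl I (S : {set I}) (i : sub S) : split_sub S (val i) = inl i.
Proof.
rewrite /split_sub; case: decP => iS; first by congr inl; apply: val_inj.
by case: iS; apply: valP.
Qed.

Lemma split_sub_inr I (S : {set I}) (i : sub (~: S)) :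
  split_sub S (val i) = inr i.
Proof.
rewrite /split_sub; case: decP => iS; last by congr inr; apply: val_inj.
by have := valP i; rewrite inE iS.
Qed.

Definition glue_labels I (S : {set I}) (A B : Type) (f : sub S -> A)
    (g : sub (~: S) -> B) (i : I) : A + B :=
  match split_sub S i with inl j => inl (f j) | inr j => inr (g j) end.

Lemma sub_cover I (S : {set I}) (Q : I -> Prop) :
  (forall i : sub S, Q (val i)) -> (forall i : sub (~: S), Q (val i)) ->
  forall i, Q i.
Proof.
move=> QS QT i; case: (boolP (i \in S)) => iS; first exact: QS (exist _ i iS).
by have iT : i \in ~: S; [rewrite inE | exact: QT (exist _ i iT)].
Qed.

Lemma restr_surj I (S : {set I}) (x : sub S -> R) (y : sub (~: S) -> R) :
  exists z : I -> R, restr S z = x /\ restr (~: S) z = y.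
Proof.
exists (fun i => match split_sub S i with inl j => x j | inr j => y j end).
by split; apply/funext => i; rewrite /restr ?split_sub_inl ?split_sub_inr.
Qed.

Lemma pairing_split I (S : {set I}) (y x : I -> R) :
  pairing y x = pairing (restr S y) (restr S x)
              + pairing (restr (~: S) y) (restr (~: S) x).
Proof.
rewrite /pairing (bigID (mem S)) /=; congr (_ + _); first by rewrite big_sub.
by rewrite -[RHS](big_sub (mem (~: S)) (fun i => y i * x i)); apply: eq_bigl => i; rewrite inE.
Qed.

Lemma max_face_prod I (S : {set I}) (p : set (sub S -> R))
    (q : set (sub (~: S) -> R)) y : p !=set0 -> q !=set0 ->
  max_face (poly_prod p q) y =
  poly_prod (max_face p (restr S y)) (max_face q (restr (~: S) y)).
Proof.
move=> [p0 pp0] [q0 qq0]; apply/seteqP; split=> x.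
  move=> [[px qx] xmax]; split; split=> // z hz.
    have [w [w1 w2]] := restr_surj z (restr (~: S) x).
    have := xmax w; rewrite !(pairing_split S) w1 w2 lerD2r; apply.
    by rewrite /poly_prod /= w1 w2.
  have [w [w1 w2]] := restr_surj (restr S x) z.
  have := xmax w; rewrite !(pairing_split S) w1 w2 lerD2l; apply.
  by rewrite /poly_prod /= w1 w2.
move=> [[px pmax] [qx qmax]]; split=> // z [pz qz].
by rewrite !(pairing_split S) lerD ?pmax ?qmax.
Qed.

Lemma pibar_mul_class I (S : {set I}) L L' (f : sub S -> L)
    (g : sub (~: S) -> L') :
  pibar_mul (label_class f) (label_class g) = label_class (glue_labels f g).
Proof.
pose G := [set p' | exists p q, [/\ val (label_class f) p, val (label_class g) q
                                  & p' = poly_prod p q]].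
have -> : pibar_mul (label_class f) (label_class g) =
    to_pibar [set q' | exists2 q, G q & nclass q q'].
  congr to_pibar; apply/seteqP; split=> q'.
    by case=> p [q [fp gq pq]]; exists (poly_prod p q) => //; exists p, q.
  by case=> _ [p [q [fp gq ->]]] pq; exists p, q.
apply: to_pibar_class => [|_ [p [q [fp gq ->]]] y y'].
  by exists (poly_prod (block_perm f) (block_perm g)), (block_perm f), (block_perm g);
    split=> //; apply: label_class_mem.
have [[polp _] pf] := (label_classP f p).1 fp.
have [[polq _] qg] := (label_classP g q).1 gq.
have nonempty J (r : set (J -> R)) : nonempty_polytope r -> r !=set0.
  by move=> /(max_face_nonempty (fun=> 0))[x [rx _]]; exists x.
rewrite /face_le !max_face_prod; try exact: nonempty.
have -> : braid_le (glue_labels f g) y y' <->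
    braid_le f (restr S y) (restr S y') /\
    braid_le g (restr (~: S) y) (restr (~: S) y').
  split=> [yy'|[fyy' gyy']].
    split=> i j ij; apply: yy'.
      by rewrite /glue_labels !split_sub_inl ij.
    by rewrite /glue_labels !split_sub_inr ij.
  apply: (@sub_cover _ S) => i; apply: (@sub_cover _ S) => j;
    rewrite /glue_labels ?split_sub_inl ?split_sub_inr // => -[] ij.
    exact: fyy'.
  exact: gyy'.
rewrite -pf -qg; split=> [le_yy|[le1 le2] x [/le1 x1 /le2 x2] //].
split=> x xmax.
  have [z zmax] := max_face_nonempty (restr (~: S) y) polq.
  have [w [w1 w2]] := restr_surj x z.
  by have [] := le_yy w; rewrite /poly_prod /= w1 w2.
have [z zmax] := max_face_nonempty (restr S y) polp.
have [w [w1 w2]] := restr_surj z x.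
by have [] := le_yy w; rewrite /poly_prod /= w1 w2.
Qed.

Definition extend0 I (U : {set I}) (y : sub U -> R) (i : I) : R :=
  if insub i is Some j then y j else 0.

Lemma extend0_in I (U : {set I}) (y : sub U -> R) j : extend0 y (val j) = y j.
Proof. by rewrite /extend0 valK. Qed.

Lemma extend0_out I (U : {set I}) (y : sub U -> R) i :
  i \notin U -> extend0 y i = 0.
Proof. by move=> iU; rewrite /extend0 insubN. Qed.

Lemma pairing_extend0 I (U : {set I}) (y : sub U -> R) (x : I -> R) :
  pairing (extend0 y) x = pairing y (restr U x).
Proof.
rewrite /pairing (bigID (mem U)) /= [X in _ + X]big1 ?addr0.
  by rewrite big_sub; apply: eq_bigr => i _; rewrite extend0_in.
by move=> i iU; rewrite extend0_out ?mul0r.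
Qed.

(** The face of the projection maximizing [y] is the projection of the face of
    [p] maximizing a small perturbation of the indicator of [S] by [y].  The
    perturbation does not change the order of entries on different sides of
    [S], so what remains are the comparisons of [y] within the blocks. *)
Lemma face_le_proj I L (f : I -> L) (S U : {set I}) (p : set (I -> R)) :
  U = S \/ U = ~: S -> nonempty_polytope p ->
  (forall y y', face_le p y y' <-> braid_le f y y') ->
  forall y y',
    face_le [set restr U x | x in max_face p (indicator R S)] y y' <->
    braid_le (fun i : sub U => f (val i)) y y'.
Proof.
move=> US polp pf y y'; set F := max_face p _; set q := image _ _.
have faceE u x : F x -> max_face F (extend0 u) x <-> max_face q u (restr U x).
  move=> Fx; split=> -[hx xmax]; split.
  - by exists x.
  - by move=> _ [z Fz <-]; rewrite -!pairing_extend0; apply: xmax.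
  - by [].
  - by move=> z Fz; rewrite !pairing_extend0; apply: xmax; exists z.
have leE : face_le q y y' <-> face_le F (extend0 y) (extend0 y').
  split=> le_yy x.
    by case=> Fx xmax; apply/faceE => //; apply: le_yy; apply/faceE.
  case=> -[z Fz <-] xmax; apply/faceE => //; apply: le_yy.
  by apply/faceE => //; split=> //; exists z.
have [t1 t1_gt0 t1P] := max_face_perturb (indicator R S) (extend0 y) polp.
have [t2 t2_gt0 t2P] := max_face_perturb (indicator R S) (extend0 y') polp.
pose M := 1 + \sum_j `|y j| + \sum_j `|y' j|.
have M_gt0 : 0 < M by rewrite /M -addrA ltr_pwDl // addr_ge0 ?sumr_ge0.
(* Small enough for both perturbations, and for the perturbed entries not to
   move by 1 or more. *)
pose t := Num.min (Num.min t1 t2) M^-1 / 2.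
have t_gt0 : 0 < t by rewrite divr_gt0 // !lt_min t1_gt0 t2_gt0 invr_gt0.
have t_lt : t < Num.min (Num.min t1 t2) M^-1.
  by rewrite /t; move: t_gt0; rewrite /t; lra.
move: (t_lt); rewrite !lt_min => /andP[/andP[tt1 tt2] tM].
apply: (iff_trans leE); rewrite /face_le /F -(t1P t) ?t_gt0 // -(t2P t) ?t_gt0 //.
apply: (iff_trans (pf _ _)).
pose z (u : sub U -> R) (i : I) := indicator R S i + t * extend0 u i.
have small u j : u = y \/ u = y' -> `|t * extend0 u j| < 1.
  move=> uy; have [jU|jU] := boolP (j \in U); last first.
    by rewrite extend0_out // mulr0 normr0.
  have -> : j = val (exist (fun i => i \in U) j jU) by [].
  rewrite extend0_in normrM gtr0_norm //.
  set j' := exist _ j jU.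
  have uM : `|u j'| <= M.
    have sum_le (v : sub U -> R) : `|v j'| <= \sum_j `|v j|.
      by rewrite (bigD1 j') //= lerDl sumr_ge0.
    have Sy : 0 <= \sum_j `|y j| by rewrite sumr_ge0.
    have Sy' : 0 <= \sum_j `|y' j| by rewrite sumr_ge0.
    by have := sum_le u; rewrite /M; case: uy => ->; lra.
  apply: (@le_lt_trans _ _ (t * M)); first by rewrite ler_wpM2l // ltW.
  by rewrite -(mulVf (lt0r_neq0 M_gt0)) ltr_pM2r.
have z_lt u i j : u = y \/ u = y' -> i \notin S -> j \in S -> z u i < z u j.
  move=> uy iS jS; rewrite /z /indicator (negPf iS) jS /=.
  have := small u i uy; have := small u j uy; rewrite !ltr_norml.
  case: US => US.
    rewrite (extend0_out u (_ : i \notin U)) ?US // mulr0.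
    by move=> /andP[? ?] _; lra.
  rewrite (extend0_out u (_ : j \notin U)) ?US ?inE ?jS // mulr0.
  by move=> _ /andP[? ?]; lra.
have side (i j : I) : i \in U -> j \in U -> (i \in S) = (j \in S).
  by case: US => ->; [move=> -> -> | rewrite !inE => /negPf-> /negPf->].
have z_in u (i j : sub U) : (z u (val i) <= z u (val j)) = (u i <= u j).
  rewrite /z; have -> : indicator R S (val i) = indicator R S (val j) :> R.
    by rewrite /indicator (side _ _ (valP i) (valP j)).
  by rewrite lerD2l ler_pM2l // !extend0_in.
split=> [zz' i j fij|yy' i j fij].
  by rewrite -!z_in; apply: zz'.
change (z y i <= z y j -> z y' i <= z y' j).
have [iU|iU] := boolP (i \in U); have [jU|jU] := boolP (j \in U).
- have := yy' (exist _ i iU) (exist _ j jU) fij.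
  by rewrite -2!z_in.
all: have [iS|iS] := boolP (i \in S); have [jS|jS] := boolP (j \in S).
all: try by move=> _; apply/ltW/z_lt => //; right.
all: try by rewrite leNgt z_lt //; left.
all: try by case: US iU jU => ->; rewrite ?inE ?iS ?jS ?(negPf iS) ?(negPf jS).
all: by rewrite /z !extend0_out // !mulr0 !addr0 /indicator ?iS ?jS ?(negPf iS) ?(negPf jS).
Qed.

(** Since the face is a nonempty product, its factors are its projections. *)
Lemma poly_coprodE I (S : {set I}) (p : set (I -> R)) q r :
  nonempty_polytope p -> poly_coprod (S := S) p q r ->
  q = [set restr S x | x in max_face p (indicator R S)] /\
  r = [set restr (~: S) x | x in max_face p (indicator R S)].
Proof.
move=> /(max_face_nonempty (indicator R S))[x0 Fx0] pqr.
rewrite -(pqr : poly_prod q r = _) in Fx0 *; have [qx0 rx0] := Fx0.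
split; apply/seteqP; split=> z.
- by move=> qz; have [w [w1 w2]] := restr_surj z (restr (~: S) x0);
    exists w; rewrite /poly_prod /= ?w1 ?w2.
- by case=> w [qw _] <-.
- by move=> rz; have [w [w1 w2]] := restr_surj (restr S x0) z;
    exists w; rewrite /poly_prod /= ?w1 ?w2.
- by case=> w [_ rw] <-.
Qed.

Lemma pibar_restr_class I L (f : I -> L) (S : {set I}) :
  pibar_restr S (label_class f) = label_class (fun i : sub S => f (val i)).
Proof.
pose G q := exists p r, val (label_class f) p /\ poly_coprod (S := S) p q r.
have -> : pibar_restr S (label_class f) =
    to_pibar [set q' | exists2 q, G q & nclass q q'].
  congr to_pibar; apply/seteqP; split=> q'.
    by case=> p [q [r [fp pqr qq']]]; exists q => //; exists p, r.
  by case=> q [p [r [fp pqr]]] qq'; exists p, q, r.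
apply: to_pibar_class => [|q [p [r [/label_classP[[polp _] pf] /(poly_coprodE polp)[-> _]]]]].
  have [q [r pqr]] := block_perm_coprod R f S.
  by exists q, (block_perm f), r; split=> //; apply: label_class_mem.
by apply: face_le_proj => //; left.
Qed.

Lemma pibar_contr_class I L (f : I -> L) (S : {set I}) :
  pibar_contr S (label_class f) = label_class (fun i : sub (~: S) => f (val i)).
Proof.
pose G r := exists p q, val (label_class f) p /\ poly_coprod (S := S) p q r.
have -> : pibar_contr S (label_class f) =
    to_pibar [set r' | exists2 r, G r & nclass r r'].
  congr to_pibar; apply/seteqP; split=> r'.
    by case=> p [q [r [fp pqr rr']]]; exists r => //; exists p, q.
  by case=> r [p [q [fp pqr]]] rr'; exists p, q, r.
apply: to_pibar_class => [|r [p [q [/label_classP[[polp _] pf] /(poly_coprodE polp)[_ ->]]]]].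
  have [q [r pqr]] := block_perm_coprod R f S.
  by exists r, (block_perm f), q; split=> //; apply: label_class_mem.
by apply: face_le_proj => //; right.
Qed.

(** Any two functionals on a zero-dimensional space are equal. *)
Lemma pibar_one_class L (f : void -> L) : pibar_one R = label_class f.
Proof.
rewrite /pibar_one /label_class; congr to_pibar; apply: nclassE => y y'.
have -> : y = y' by apply/funext => -[].
by split=> _; [move=> i j _ | move=> x].
Qed.

End Classes.

(** * Linear maps on free modules *)

Section FreeModules.
Context (k : fieldType) (K : choiceType).

Section Lift.
Context (M : lmodType k) (g : K -> M).

HB.instance Definition _ :=
  GRing.isZmodMorphism.Build {freeg K / k} M (fglift g) (lift_is_additive g).

Lemma fglift_scale c (D : {freeg K / k}) : fglift g (c *: D) = c *: fglift g D.
Proof.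
rewrite -[in RHS](freeg_sumE D) [c *: D]/(fgscale c D) /fgscale !raddf_sum /=.
by apply: eq_bigr => x _; rewrite !liftU scalerA.
Qed.

Lemma fglift_linear : linear (fglift g).
Proof. by move=> c D E; rewrite raddfD /= fglift_scale. Qed.

End Lift.

Lemma fgliftU1 (M : lmodType k) (g : K -> M) C :
  fglift g (<< C >> : {freeg K / k}) = g C.
Proof. by rewrite liftU scale1r. Qed.

Lemma scalar_eq (F G : {freeg K / k} -> k) : scalar F -> scalar G ->
  (forall C, F << C >> = G << C >>) -> F =1 G.
Proof.
move=> linF linG FG.
have zero (H : {freeg K / k} -> k) : scalar H -> H 0 = 0.
  by move=> linH; have := linH (-1) 0 0; rewrite scaler0 addr0 mulN1r addNr.
elim/freeg_ind_dom0 => [|c C D _ _ IH]; first by rewrite !zero.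
have -> : << c *g C >> = c *: (<< C >> : {freeg K / k}).
  by apply/eqP/freeg_eqP => E; rewrite coeffZ !coeffU mul1r.
by rewrite linF linG FG IH.
Qed.

End FreeModules.

(** * Characters are sequences *)

Section Characters.
Context (R : realType) (k : fieldType).
Implicit Types (I J L : finType) (a b : nat -> k) (zeta : char_family R k).

(** The labeling chosen for [C] does not matter, by [label_prod_kernel] and
    [label_class_kernel]. *)
Definition char_val a I (C : Pibar R I) : k :=
  label_prod a (projT1 (cid (label_class_surj C))).

Lemma char_val_class a I L (f : I -> L) : a 0%N = 1 ->
  char_val a (label_class R f) = label_prod a f.
Proof.
move=> a0; rewrite /char_val; case: cid => g fg /=.
by apply: label_prod_kernel => // i j; rewrite -(label_class_kernel fg).
Qed.

Definition char_of a : char_family R k :=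
  fun I => fglift (fun C : Pibar R I => char_val a C : k^o).

Lemma char_of_linear a I : scalar (@char_of a I).
Proof. by move=> c D E; rewrite /char_of fglift_linear. Qed.

Lemma char_ofU a I L (f : I -> L) : a 0%N = 1 ->
  @char_of a I << label_class R f >> = label_prod a f.
Proof. by move=> a0; rewrite /char_of fgliftU1 char_val_class. Qed.

Lemma label_prod_bij a I J L (sigma : I -> J) (f : J -> L) :
  bijective sigma -> label_prod a (f \o sigma) = label_prod a f.
Proof.
move=> [tau sigmaK tauK]; apply: eq_bigr => l _; congr (a _).
rewrite -(card_imset _ (can_inj sigmaK)); apply: eq_card => j; rewrite inE.
apply/imsetP/idP => [[i + ->]|fj]; first by rewrite inE.
by exists (tau j); rewrite ?inE /= ?tauK.
Qed.

Lemma label_prod_glue a I (S : {set I}) L L' (f : sub S -> L)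
    (g : sub (~: S) -> L') :
  label_prod a (glue_labels f g) = label_prod a f * label_prod a g.
Proof.
rewrite /label_prod big_sumType; congr (_ * _); apply: eq_bigr => l _; congr (a _).
  rewrite -[RHS](card_imset _ val_inj); apply: eq_card; apply: (@sub_cover _ S) => i.
    rewrite mem_imset; last exact: val_inj.
    by rewrite !inE /glue_labels split_sub_inl.
  rewrite inE /glue_labels split_sub_inr /=; apply/esym/imsetP => -[j _ ij].
  by have := valP i : sval i \in ~: S; rewrite ij inE (valP j : sval j \in S).
rewrite -[RHS](card_imset _ val_inj); apply: eq_card; apply: (@sub_cover _ S) => i.
  rewrite inE /glue_labels split_sub_inl /=; apply/esym/imsetP => -[j _ ij].
  by have := valP j : sval j \in ~: S; rewrite -ij inE (valP i : sval i \in S).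
rewrite mem_imset; last exact: val_inj.
by rewrite !inE /glue_labels split_sub_inr.
Qed.

Lemma kpibar_mulU I (S : {set I}) (C : Pibar R (sub S)) (D : Pibar R (sub (~: S))) :
  kpibar_mul (<< C >> : kPibar R k _) << D >> = << pibar_mul C D >>.
Proof. by rewrite /kpibar_mul !fgliftU1. Qed.

Lemma char_of_is_character a : a 0%N = 1 -> is_character (char_of a).
Proof.
move=> a0; split=> [I|I J sigma|I S|].
- exact: char_of_linear.
- move=> + bij; apply: scalar_eq => [c D E||C].
  + by rewrite /kpibar_relabel fglift_linear char_of_linear.
  + exact: char_of_linear.
  have [f ->] := label_class_surj C; have [tau sigmaK tauK] := bij.
  have fE : f = (f \o tau) \o sigma by apply/funext => i /=; rewrite sigmaK.
  rewrite /kpibar_relabel fgliftU1 fE pibar_relabel_class // !char_ofU //.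
  by rewrite (label_prod_bij a (f \o tau) bij).
- move=> x y; move: x; apply: scalar_eq => [c D E|c D E|C].
  + by rewrite /kpibar_mul fglift_linear char_of_linear.
  + by rewrite char_of_linear mulrDl mulrA.
  move: y; apply: scalar_eq => [c D E|c D E|D].
  + by rewrite /kpibar_mul !fgliftU1 fglift_linear char_of_linear.
  + by rewrite char_of_linear mulrDr mulrCA.
  rewrite kpibar_mulU; have [f ->] := label_class_surj C.
  have [g ->] := label_class_surj D.
  by rewrite pibar_mul_class !char_ofU // label_prod_glue.
rewrite (pibar_one_class R (fun=> tt)) char_ofU // /label_prod big1 // => l _.
by rewrite (eq_card0 (fun i : void => match i with end)).
Qed.

Definition char_coef zeta (n : nat) : k :=
  zeta 'I_n << label_class R (fun _ : 'I_n => tt) >>.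

Lemma char_const zeta I : is_character zeta ->
  zeta I << label_class R (fun _ : I => tt) >> = char_coef zeta #|I|.
Proof.
move=> zetaP; have bij := @enum_rank_bij I.
rewrite /char_coef -(character_natural zetaP _ bij) /kpibar_relabel fgliftU1.
by rewrite (pibar_relabel_class R (fun=> tt) bij).
Qed.

Lemma char_empty zeta I L (f : I -> L) : is_character zeta -> #|I| = 0%N ->
  zeta I << label_class R f >> = 1.
Proof.
move=> zetaP I0; have noI (i : I) : False by have := fintype0 i I0.
pose sigma (v : void) : I := match v with end.
have bij : bijective sigma.
  by exists (fun i => False_rect void (noI i)) => [[]|i]; case: (noI i).
apply: etrans (character_one zetaP); rewrite (pibar_one_class R (f \o sigma)).
by rewrite -(character_natural zetaP _ bij) /kpibar_relabel fgliftU1 pibar_relabel_class.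
Qed.

Lemma char_coef0 zeta : is_character zeta -> char_coef zeta 0 = 1.
Proof. by move=> zetaP; apply: char_empty; rewrite ?card_ord. Qed.

(** Splitting off one block at a time, a character is determined by its values
    on single permutahedra. *)
Lemma char_label_class zeta : is_character zeta ->
  forall I L (f : I -> L),
    zeta I << label_class R f >> = label_prod (char_coef zeta) f.
Proof.
move=> zetaP I L f; have [n] := ubnP #|I|; elim: n I f => // n IH I f leIn.
have a0 := char_coef0 zetaP.
have [I0|] := posnP #|I|.
  rewrite char_empty // /label_prod big1 // => l _.
  by have -> : #|fiber f l| = 0%N by apply: eq_card0 => i; have := fintype0 i I0.
case/card_gt0P => i0 _; pose S := fiber f (f i0).
pose g (i : sub (~: S)) := f (val i).
have -> : label_class R f = label_class R (glue_labels (fun _ : sub S => tt) g).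
  apply: eq_label_class; apply: (@sub_cover _ S) => i; apply: (@sub_cover _ S) => j;
    rewrite /glue_labels ?split_sub_inl ?split_sub_inr //.
  - by have := valP i; have := valP j; rewrite !inE => /eqP-> /eqP->; rewrite !eqxx.
  - by have := valP i; have := valP j; rewrite !inE eq_sym => jS /eqP->; rewrite (negPf jS).
  - by have := valP i; have := valP j; rewrite !inE => /eqP-> iS; rewrite (negPf iS).
(* The block [S] has the single label [tt], and the label [f i0] becomes unused
   in [g], where it contributes [a 0 = 1]. *)
rewrite -pibar_mul_class -kpibar_mulU (character_mul zetaP) char_const // IH; last first.
  rewrite card_sig -ltnS; apply: leq_trans leIn; rewrite ltnS.
  rewrite -cardsT; apply: proper_card; apply/properP; split.
    by apply/fintype.subsetP => i; rewrite inE.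
  by exists i0; rewrite !inE ?eqxx.
rewrite /label_prod [RHS](bigD1 (f i0)) //= (bigD1 (f i0)) //=.
have -> : #|fiber g (f i0)| = 0%N.
  by apply: eq_card0 => i; have := valP i; rewrite !inE => /negPf.
rewrite a0 mul1r card_sig; congr (_ * _).
apply: eq_bigr => l l_fi0; congr (char_coef zeta _).
rewrite card_fiber_restr; apply: eq_card => i; rewrite !inE.
by case: (f i =P l) => [->|]; rewrite ?andbF // l_fi0.
Qed.

Lemma char_ofK a : a 0%N = 1 -> char_coef (char_of a) = a.
Proof.
move=> a0; apply/funext => n; rewrite /char_coef char_ofU // /label_prod.
rewrite (bigD1 tt) //= big1 ?mulr1; last by case.
by congr (a _); rewrite -[RHS]card_ord; apply: eq_card => i; rewrite !inE.
Qed.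

Lemma char_coefK zeta : is_character zeta -> char_of (char_coef zeta) = zeta.
Proof.
move=> zetaP; apply: functional_extensionality_dep => I; apply/funext.
apply: scalar_eq => [||C]; [exact: char_of_linear | exact: character_linear |].
have [f ->] := label_class_surj C.
by rewrite char_ofU ?char_coef0 // char_label_class.
Qed.

Lemma char_of_conv a b : a 0%N = 1 -> b 0%N = 1 ->
  convolution (char_of a) (char_of b) = char_of (binomial_conv a b).
Proof.
move=> a0 b0; apply: functional_extensionality_dep => I.
apply: (congr1 (fun g : Pibar R I -> k^o => fglift g)); apply/funext => C.
have [f ->] := label_class_surj C.
rewrite char_val_class; last by rewrite /binomial_conv big_ord1 a0 b0 mul1r bin0.
rewrite -sum_label_prod; apply: eq_bigr => S _.
by rewrite pibar_restr_class pibar_contr_class !char_ofU.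
Qed.

End Characters.

(** A group structure can be transported back along an isomorphism from a set
    that is merely closed under its operation. *)
Lemma iso_is_group (T U : Type) (G : T -> Prop) (opG : T -> T -> T)
    (H : U -> Prop) (opH : U -> U -> U) (f : T -> U) :
  (forall x y, G x -> G y -> G (opG x y)) ->
  is_group_iso G opG H opH f -> is_group H opH -> is_group G opG.
Proof.
move=> closedG [fH f_inj f_surj fM] [closedH assocH [e [He e1 eV]]].
split=> // [x y z Gx Gy Gz|].
  by apply: f_inj; rewrite ?fM ?assocH; auto.
have [u Gu ue] := f_surj e He.
exists u; split=> // x Gx.
  by split; apply: f_inj; rewrite ?fM ?ue //; auto; have [] := e1 (f x) (fH x Gx).
have [v [Hv xv vx]] := eV (f x) (fH x Gx); have [y Gy yv] := f_surj v Hv.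
by exists y; split=> //; apply: f_inj; rewrite ?fM ?yv ?ue; auto.
Qed.

Theorem theorem9p2 (R : realType) (k : fieldType) (char0 : [pchar k] =i pred0) :
  [/\ is_group (@is_character R k) (@convolution R k),
      is_group (@is_unital_exp_series k) (@fps_mul k)
    & exists Phi : char_family R k -> fps k,
        is_group_iso (@is_character R k) (@convolution R k)
                     (@is_unital_exp_series k) (@fps_mul k) Phi].
Proof.
have conv0 (a b : nat -> k) : a 0%N = 1 -> b 0%N = 1 -> binomial_conv a b 0%N = 1.
  by move=> a0 b0; rewrite /binomial_conv big_ord1 a0 b0 mul1r bin0.
pose Phi (zeta : char_family R k) : fps k := exp_series (char_coef zeta).
have convE (phi psi : char_family R k) : is_character phi -> is_character psi ->
    convolution phi psi = char_of (binomial_conv (char_coef phi) (char_coef psi)).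
  move=> phiP psiP; rewrite -{1}(char_coefK phiP) -{1}(char_coefK psiP).
  by rewrite char_of_conv ?char_coef0.
have closed (phi psi : char_family R k) : is_character phi -> is_character psi ->
    is_character (convolution phi psi).
  by move=> phiP psiP; rewrite convE //; apply: char_of_is_character;
    rewrite conv0 ?char_coef0.
have PhiP : is_group_iso (@is_character R k) (@convolution R k)
    (@is_unital_exp_series k) (@fps_mul k) Phi.
  split=> [phi phiP|phi psi phiP psiP|_ [a a0 ->]|phi psi phiP psiP].
  - by exists (char_coef phi); rewrite ?char_coef0.
  - by move=> /(exp_series_inj char0) ab; rewrite -(char_coefK phiP) ab char_coefK.
  - by exists (char_of (R := R) a); rewrite /Phi ?char_ofK //; apply: char_of_is_character.
  - rewrite /Phi -exp_series_conv // convE // char_ofK //.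
    by rewrite conv0 ?char_coef0.
have fpsP := fps_group char0.
by split=> //; [exact: iso_is_group closed PhiP fpsP | exists Phi].
Qed.
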